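(* For any partitions $\mu,\nu$ and any $n,m\ge1$, $$\sum_\lambda\widetilde{\mathsf F}^*_{\lambda'/\nu'}(u_1,\dots,u_m\mid\Xi,\mathsf{S})\,\mathbb{F}_{\lambda/\mu}(\kappa_1,\dots,\kappa_n\mid\Xi,\mathsf{S})$$ $$=\prod_{i=1}^n\prod_{j=1}^m\frac{1-u_j\kappa_i}{1-u_j\xi_is_i}\ \sum_{\lambda}\mathbb{F}_{\nu/\lambda}(\kappa_1,\dots,\kappa_n\mid\Xi,\mathsf{S})\,\widetilde{\mathsf F}^*_{\mu'/\lambda'}(u_1,\dots,u_m\mid\tau^n_{\mathsf{S}}\Xi,\tau^n_{\Xi}\mathsf{S}),$$ where both sums are over all partitions $\lambda$ and each has only finitely many nonzero terms.
   Context: Fix a generic parameter $q$, and write $(x;q)_n:=\prod_{i=1}^n(1-xq^{i-1})$, $(x;q)_0:=1$. A partition is a weakly decreasing sequence $\lambda=(\lambda_1\ge\lambda_2\ge\dots\ge0)$ of nonnegative integers with finitely many nonzero entries; $l(\lambda)$ is the number of nonzero parts and $\lambda'$ is the conjugate partition, so the number of parts of $\lambda'$ equal to $j$ is $m_j(\lambda')=\lambda_j-\lambda_{j+1}$. Let $\Xi=(\xi_0,\xi_1,\dots)$ and $\mathsf{S}=(s_0,s_1,\dots)$ be sequences of generic parameters, with fixed square roots $\sqrt{\xi_i},\sqrt{s_i}$. For $k\ge0$ put $\xi_i^{(k)}:=\sqrt{\xi_{i+k}s_{i+k}\xi_i/s_i}$, $s_i^{(k)}:=\sqrt{s_{i+k}\xi_{i+k}s_i/\xi_i}$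 (formed from the fixed roots), $\tau^k_{\mathsf{S}}\Xi:=(\xi^{(k)}_0,\xi^{(k)}_1,\dots)$, $\tau^k_{\Xi}\mathsf{S}:=(s^{(k)}_0,s^{(k)}_1,\dots)$. Put $\mathsf{c}_{\mathsf{S}}(\lambda):=\prod_{i\ge1}\frac{(s_i^2;q)_{\lambda_i-\lambda_{i+1}}}{(q;q)_{\lambda_i-\lambda_{i+1}}}$, $(-\mathsf{S})^\lambda:=\prod_{i\ge1}(-s_{i-1})^{\lambda_i}$ (likewise for other sequences in place of $\mathsf S$). Functions $\mathbb{F}_{\lambda/\mu}$. For $i,j,k,l\in\mathbb{Z}_{\ge0}$ (labels of the bottom, left, top, right edge) let $$W_{t,s}(i,j;k,l):=\mathbf{1}_{i+j=k+l}\,\mathbf{1}_{i\ge l}\,(s^2/t^2)^{l}\frac{(s^2/t^2;q)_{i-l}(t^2;q)_l}{(s^2;q)_i}\frac{(q;q)_i}{(q;q)_{i-l}(q;q)_l}.$$ For $a_1,\dots,a_n\in\mathbb{Z}_{\ge0}$ and $L>l(\lambda),l(\mu)$, $$ZW^{(a_1,\dots,a_n)}_{\lambda/\mu}(\kappa_1,\dots,\kappa_n\mid\Xi,\mathsf{S}):=\sum\prod_{r=1}^n\prod_{c=1}^L W_{t_{r,c},\,s^{(r)}_c}(v_{r,c},h_{r,c-1};v_{r-1,c},h_{r,c}),\qquad t_{r,c}^2=\frac{\xi_{r+c}s_{r+c}}{\kappa_r},$$ the sum being over all nonnegative integers $v_{r,c}$ ($0\le r\le n$, $1\le c\le L$)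 and $h_{r,c}$ ($1\le r\le n$, $0\le c\le L$) with $v_{0,c}=m_c(\lambda')$, $v_{n,c}=m_c(\mu')$, $h_{r,0}=a_r$, $h_{r,L}=0$ (independent of $L$). Then $$\mathbb{F}_{\lambda/\mu}(\kappa_1,\dots,\kappa_n\mid\Xi,\mathsf{S}):=\frac{(-\tau^n_\Xi\mathsf{S})^{\mu}}{(-\mathsf{S})^{\lambda}}\frac{\mathsf{c}_{\tau^n_\Xi\mathsf{S}}(\mu)}{\mathsf{c}_{\mathsf{S}}(\lambda)}\sum_{a_1+\dots+a_n=\lambda_1-\mu_1}\Bigl(\prod_{i=1}^n(\kappa_is_0/\xi_0)^{a_i}\frac{(\kappa_i^{-1}s_i\xi_i;q)_{a_i}}{(q;q)_{a_i}}\Bigr)ZW^{(a_1,\dots,a_n)}_{\lambda/\mu}(\kappa_1,\dots,\kappa_n\mid\Xi,\mathsf{S}).$$ Functions $\widetilde{\mathsf F}^*_{\lambda'/\mu'}$. For $g\in\mathbb{Z}_{\ge0}$ let $w_{u;s}(i,j;k,l)$ ($i,k\in\mathbb{Z}_{\ge0}$ bottom and top labels, $j,l\in\{0,1\}$ left and right labels) be $$w_{u;s}(g,0;g,0)=\frac{1-suq^g}{1-su},\quad w_{u;s}(g,0;g-1,1)=\frac{(q^g-1)su}{1-su},\quad w_{u;s}(g,1;g+1,0)=\frac{1-s^2q^g}{1-su},\quad w_{u;s}(g,1;g,1)=\frac{s^2q^g-su}{1-su},$$ and $0$ otherwise. For $a_1,\dots,a_m\in\{0,1\}$ and $L>l(\lambda),l(\mu)$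 let $$Zw^{(a_1,\dots,a_m)}_{\lambda/\mu}(u_1,\dots,u_m\mid\Xi,\mathsf{S}):=\sum\prod_{r=1}^m\prod_{c=1}^L w_{u_r\xi_c;\,s_c}(v_{r,c},h_{r,c-1};v_{r-1,c},h_{r,c}),$$ the sum being over $v_{r,c}\in\mathbb{Z}_{\ge0}$, $h_{r,c}\in\{0,1\}$ with $v_{0,c}=m_c(\lambda')$, $v_{m,c}=m_c(\mu')$, $h_{r,0}=a_r$, $h_{r,L}=0$ (independent of $L$). Set $$\widetilde{\mathsf F}_{\lambda'/\mu'}(u_1,\dots,u_m\mid\Xi,\mathsf{S}):=\frac{(-\mathsf{S})^\mu}{(-\mathsf{S})^\lambda}\frac{\mathsf{c}_{\mathsf{S}}(\mu)}{\mathsf{c}_{\mathsf{S}}(\lambda)}\sum_{a_1,\dots,a_m\in\{0,1\}}\Bigl(\prod_{i=1}^m(-u_i\xi_0s_0)^{a_i}\Bigr)Zw^{(a_1,\dots,a_m)}_{\lambda/\mu}(u_1,\dots,u_m\mid\Xi,\mathsf{S}),$$ $$\widetilde{\mathsf F}^*_{\lambda'/\mu'}(u_1,\dots,u_m\mid\Xi,\mathsf{S}):=\frac{\mathsf{c}_{\mathsf{S}}(\lambda)}{\mathsf{c}_{\mathsf{S}}(\mu)}\,\widetilde{\mathsf F}_{\lambda'/\mu'}(u_1,\dots,u_m\mid\Xi,\mathsf{S}).$$ *)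

(* Defs.v *)
From HB Require Import structures.
From mathcomp Require Import all_boot all_algebra.
From mathcomp Require Import boolp classical_sets functions cardinality fsbigop.

Set Implicit Arguments.
Unset Strict Implicit.
Unset Printing Implicit Defensive.

Import GRing.Theory.
Local Open Scope classical_set_scope.
Local Open Scope ring_scope.

(* A partition is the weakly decreasing list of its nonzero parts, so that    *)
(* size la is l(la).                                                          *)
Definition is_intpart (la : seq nat) : bool := sorted geq la && (0%N \notin la).

Record intpart := IntPart {
  parts :> seq nat;
  intpartP : is_intpart parts
}.

HB.instance Definition _ := [isSub for parts].
HB.instance Definition _ := [Choice of intpart by <:].

(* la_i with 1-based index i >= 1; it is 0 beyond l(la).                      *)
Definition part (la : intpart) (i : nat) : nat := nth 0%N la i.-1.

(* m_j(la'), the multiplicity of j >= 1 in the conjugate partition.           *)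
Definition mconj (la : intpart) (j : nat) : nat := part la j - part la j.+1.

Section Functions.
Variable F : fieldType.
Implicit Types (q kappa u s x y : F) (la mu : intpart) (Xi S rXi rS : nat -> F).

Definition qpoch q x (n : nat) : F := \prod_(i < n) (1 - x * q ^+ i).

Definition sqseq (r : nat -> F) : nat -> F := fun i => r i ^+ 2.

(* rXi and rS are the fixed square roots of the sequences Xi and S, that is,  *)
(* Xi = sqseq rXi and S = sqseq rS.  The square roots in xi_i^(k), s_i^(k)    *)
(* are the products of these.                                                 *)
Definition tauXi rXi rS (k : nat) : nat -> F :=
  fun i => rXi (i + k)%N * rS (i + k)%N * rXi i / rS i.

Definition tauS rXi rS (k : nat) : nat -> F :=
  fun i => rS (i + k)%N * rXi (i + k)%N * rS i / rXi i.

(* The omitted factors, those with i > l(la), are equal to 1.                 *)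
Definition cfun q S la : F :=
  \prod_(1 <= i < (size la).+1)
    (qpoch q (S i ^+ 2) (mconj la i) / qpoch q q (mconj la i)).

(* (-S)^la; factors with i > l(la) are again equal to 1.                      *)
Definition powS S la : F :=
  \prod_(1 <= i < (size la).+1) (- S i.-1) ^+ part la i.

(* Partition function of n rows and L columns.  Row i of v (i <= n) holds     *)
(* v_{i,c} for c = 1, ..., L, at the column of index c - 1; row r of h holds  *)
(* h_{r+1,c} for c = 0, ..., L.  The vertex in row r + 1 and column c + 1     *)
(* thus has bottom label v_{r+1,c+1}, left label h_{r+1,c}, top label         *)
(* v_{r,c+1} and right label h_{r+1,c+1}, and its weight is wt r c.+1.        *)
(* The horizontal labels live in H, with h0 for an empty edge.                *)
Definition latticeZ (H : choiceType) (h0 : H) (n L : nat)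
    (wt : 'I_n -> nat -> nat -> H -> nat -> H -> F)
    (a : 'I_n -> H) (top bottom : nat -> nat) : F :=
  \sum_(vh \in [set vh : 'M[nat]_(n.+1, L) * 'M[H]_(n, L.+1) |
         [/\ forall c : 'I_L, vh.1 ord0 c = top c.+1,
             forall c : 'I_L, vh.1 ord_max c = bottom c.+1,
             forall r : 'I_n, vh.2 r ord0 = a r &
             forall r : 'I_n, vh.2 r ord_max = h0]])
    \prod_(r < n) \prod_(c < L)
      wt r c.+1 (vh.1 (lift ord0 r) c) (vh.2 r (widen_ord (leqnSn L) c))
                (vh.1 (widen_ord (leqnSn n) r) c) (vh.2 r (lift ord0 c)).

(* An admissible number of columns: any L > l(la), l(mu) gives the same Z.    *)
Definition ncols la mu : nat := (maxn (size la) (size mu)).+1.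

(* W_{t,s} depends on t only through t2 = t^2.                                *)
Definition Wwt q (t2 s : F) (i j k l : nat) : F :=
  if (i + j == k + l)%N && (l <= i)%N then
    (s ^+ 2 / t2) ^+ l
    * (qpoch q (s ^+ 2 / t2) (i - l) * qpoch q t2 l / qpoch q (s ^+ 2) i)
    * (qpoch q q i / (qpoch q q (i - l) * qpoch q q l))
  else 0.

Definition ZW q (n : nat) (kappa : 'I_n -> F) rXi rS la mu
    (a : 'I_n -> nat) : F :=
  latticeZ 0%N (ncols la mu)
    (fun (r : 'I_n) c =>
       Wwt q (sqseq rXi (r.+1 + c)%N * sqseq rS (r.+1 + c)%N / kappa r)
             (tauS rXi rS r.+1 c))
    a (mconj la) (mconj mu).

(* F_{la/mu}(kappa | Xi, S); kappa r stands for kappa_{r+1}.                  *)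
Definition FF q (n : nat) (kappa : 'I_n -> F) rXi rS la mu : F :=
  let Xi := sqseq rXi in
  let S := sqseq rS in
  powS (tauS rXi rS n) mu / powS S la
  * (cfun q (tauS rXi rS n) mu / cfun q S la)
  * \sum_(a \in [set a : {ffun 'I_n -> nat} |
                  (\sum_(i < n) a i + part mu 1 = part la 1)%N])
      (\prod_(i < n) ((kappa i * S 0%N / Xi 0%N) ^+ a i
                      * (qpoch q ((kappa i)^-1 * S i.+1 * Xi i.+1) (a i)
                         / qpoch q q (a i)))
       * ZW q kappa rXi rS la mu a).

Definition wwt q u s (i : nat) (j : bool) (k : nat) (l : bool) : F :=
  match j, l with
  | false, false =>
      if k == i then (1 - s * u * q ^+ i) / (1 - s * u) else 0
  | false, true =>
      if i == k.+1 then (q ^+ i - 1) * s * u / (1 - s * u) else 0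
  | true, false =>
      if k == i.+1 then (1 - s ^+ 2 * q ^+ i) / (1 - s * u) else 0
  | true, true =>
      if k == i then (s ^+ 2 * q ^+ i - s * u) / (1 - s * u) else 0
  end.

Definition Zw q (m : nat) (u : 'I_m -> F) Xi S la mu (a : 'I_m -> bool) : F :=
  latticeZ false (ncols la mu)
    (fun (r : 'I_m) c => wwt q (u r * Xi c) (S c))
    a (mconj la) (mconj mu).

(* Ftilde_{la'/mu'} and Ftilde*_{la'/mu'}: the arguments are la and mu, not   *)
(* their conjugates.                                                          *)
Definition Ft q (m : nat) (u : 'I_m -> F) Xi S la mu : F :=
  powS S mu / powS S la * (cfun q S mu / cfun q S la)
  * \sum_(a : {ffun 'I_m -> bool})
      (\prod_(i < m) (- u i * Xi 0%N * S 0%N) ^+ a i)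
      * Zw q u Xi S la mu a.

Definition Ftstar q (m : nat) (u : 'I_m -> F) Xi S la mu : F :=
  cfun q S la / cfun q S mu * Ft q u Xi S la mu.

End Functions.

(* Main.v *)
(* Arrow conservation makes the horizontal labels of a row a function of the   *)
(* partitions below and above it (h_{r,c} is the difference of their parts of *)
(* index c + 1), so both functions are compositions of one-row kernels.  The  *)
(* products xi_i s_i are shifted by tau while the ratios s_i / xi_i are fixed, *)
(* so the identity for n = m = 1, applied at each level of the shift, lets    *)
(* the rows be moved past each other one at a time.                           *)
(*   For n = m = 1, sum over la one part at a time, from the largest.  Let    *)
(* L_c(y) be the sum over la_1, ..., la_c of the weights of the columns       *)
(* 1, ..., c on the left-hand side with la_{c+1} = y, multiplied by the       *)
(* denominators 1 - u xi_i s_i, and R_c(y) its analogue on the right.  Only   *)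
(* y = nu_{c+1}, nu_{c+1} + 1 occur in L_c and y = mu_{c+1}, mu_{c+1} - 1 in  *)
(* R_c.  With k = nu_{c+1} - mu_{c+1} and p = xi_{c+1} s_{c+1}, induction on  *)
(* c (a Yang-Baxter equation) gives                                           *)
(*   (1 - u kappa) R_c(mu_{c+1})                                              *)
(*     = (1 - u p q^k) L_c(nu_{c+1}) + (1 - q^(k+1)) L_c(nu_{c+1} + 1),       *)
(*   (1 - u kappa) R_c(mu_{c+1} - 1)                                          *)
(*     = - u (kappa - p q^k) L_c(nu_{c+1})                                    *)
(*       + (q^(k+1) - u kappa) L_c(nu_{c+1} + 1),                             *)
(* and after the last column k = 0 and L_c(1) = 0.                            *)

Require Import Defs.
From mathcomp Require Import all_boot all_algebra.
From mathcomp Require Import boolp classical_sets functions cardinality fsbigop.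
From mathcomp Require Import ring zify.

Set Implicit Arguments.
Unset Strict Implicit.
Unset Printing Implicit Defensive.

Import GRing.Theory.
Local Open Scope ring_scope.

(** Read a row of vertices as a matrix indexed by the partitions on its two boundaries. Summing over
    inner labels then turns each function into an entry of a product of such matrices
    ([latticeZ_chain], [Ftstar_chain], [FF_chain]), and the theorem says that a product of [m] rows
    of one kind commutes with a product of [n] rows of the other, up to a scalar. One pair of rows
    is commuted by [row_exchange]; passing a row of [FF] raises the shift level of a row of [Ftstar]
    by one and produces one factor of the scalar. [chain_exchange_right] and [chain_exchange] repeat
    this for all [m * n] pairs.

    For one pair, sum over the parts of the intermediate partition from the left. Interlacing with
    [nu] and [mu] leaves only two possible values for each part, so each side is a vector with two
    entries, updated column by column. [transfer_relation] states that one explicit 2 by 2 matrix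
    relates the two vectors after every column; its induction step is the polynomial identity
    [exchange_local]. After the last column a single entry is left on each side, and the
    denominators of the two sides telescope.

    The partitions are confined to a finite box, at most [L] parts with consecutive differences at
    most [N]. The support lemmas, which come from arrow conservation, show that the box contains
    every nonzero term. *)

(** * Column transfer *)

(* Here [y], [z], [B] stand for [q ^ k_c], [q ^ k_(c+1)] and [q ^ (e - 1)] with
   [k_c = nu_c - mu_c] and [e = mu_c - nu_(c+1)]; [a], [a1] and [b1], [b] are
   values of [row_alpha] and [row_beta] at consecutive arguments. *)
Lemma exchange_local (F : fieldType) (q w x r p p' y z B : F)
  (b b1 a a1 g L0 L1 R0 R1 : F) :
  let u := w * r in
  a1 * (1 - q * z) = a * r * (x - p' * z) ->
  b * (1 - q * B) = b1 * (1 - x * r * B) ->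
  (1 - u * x) * R0 = (1 - u * p * y) * L0 + (1 - q * y) * L1 ->
  b1 * ((1 - u * x) * R1)
    = b1 * (- u * (x - p * y) * L0 + (q * y - u * x) * L1) ->
  let L0' := a * b * g * ((1 - u * p * (y * (q * B))) * L0
                          + (1 - q * (y * (q * B))) * L1) in
  let L1' := a1 * b1 * g * (- w * (1 - p * r * (y * B)) * L0
                            + (y * (q * B) - w) * L1) in
  let R0' := a * g * (b * (1 - u * p' * (z * (q * B))) * R0
                      + b1 * (1 - p' * r * (z * B)) * R1) in
  let R1' := a1 * g * (b * (q * (z * (q * B)) - 1) * w * R0
                       + b1 * (z * (q * B) - w) * R1) in
  (1 - u * x) * R0' = (1 - u * p' * z) * L0' + (1 - q * z) * L1' /\
  (1 - u * x) * R1' = - u * (x - p' * z) * L0' + (q * z - u * x) * L1'.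
Proof.
move=> u Ha Hb H0 H1 L0' L1' R0' R1'.
(* Both differences are explicit multiples of [E]. *)
pose E := b * (1 - q * B) - b1 * (1 - x * r * B).
have E0 : E = 0 by rewrite /E Hb subrr.
split.
- have -> : (1 - u * x) * R0' =
    a * g * (b * (1 - u * p' * (z * (q * B))) * ((1 - u * x) * R0)
             + (1 - p' * r * (z * B)) * (b1 * ((1 - u * x) * R1))).
    by rewrite /R0'; ring.
  have -> : (1 - q * z) * L1' = a1 * (1 - q * z) * b1 * g *
      (- w * (1 - p * r * (y * B)) * L0 + (y * (q * B) - w) * L1).
    by rewrite /L1'; ring.
  rewrite H0 H1 Ha /L0'; apply/eqP; rewrite -subr_eq0; apply/eqP.
  transitivity (a * g * (u * (p' * z - p * y) * L0
                         + (u * p' * z - q * y) * L1) * E).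
    by rewrite /E /u; ring.
  by rewrite E0 mulr0.
- have -> : (1 - u * x) * R1' =
    a1 * g * (b * (q * (z * (q * B)) - 1) * w * ((1 - u * x) * R0)
             + (z * (q * B) - w) * (b1 * ((1 - u * x) * R1))).
    by rewrite /R1'; ring.
  have -> : - u * (x - p' * z) * L0' = - (a * r * (x - p' * z)) * w * b * g *
    ((1 - u * p * (y * (q * B))) * L0 + (1 - q * (y * (q * B))) * L1).
    by rewrite /L0' /u; ring.
  rewrite H0 H1 -Ha /L1'; apply/eqP; rewrite -subr_eq0; apply/eqP.
  transitivity (a1 * g * w * ((u * p * y - q * z) * L0
                         + q * (y - z) * L1) * E).
    by rewrite /E /u; ring.
  by rewrite E0 mulr0.
Qed.

(** * q-Pochhammer quotients and vertex weights *)

Section Weights.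
Variables (F : fieldType) (q : F).
Hypothesis hq : forall k : nat, (0 < k)%N -> q ^+ k != 1.

Lemma qpoch0 x : qpoch q x 0 = 1.
Proof. by rewrite /qpoch big_ord0. Qed.

Lemma qpochS x n : qpoch q x n.+1 = qpoch q x n * (1 - x * q ^+ n).
Proof. by rewrite /qpoch big_ord_recr. Qed.

Lemma qpoch_neq0 x n : (forall j, x * q ^+ j != 1) -> qpoch q x n != 0.
Proof.
move=> hx; rewrite /qpoch prodf_seq_neq0; apply/allP => i _ /=.
by rewrite subr_eq0 eq_sym hx.
Qed.

Lemma qpoch_q_neq0 n : qpoch q q n != 0.
Proof. by apply: qpoch_neq0 => j; rewrite -exprS hq. Qed.

Definition qratio (x : F) (n : nat) : F := qpoch q x n / qpoch q q n.

Lemma qratioS x n :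
  qratio x n.+1 * (1 - q ^+ n.+1) = qratio x n * (1 - x * q ^+ n).
Proof.
have hn : 1 - q ^+ n.+1 != 0 by rewrite subr_eq0 eq_sym hq.
have := qpoch_q_neq0 n.
rewrite /qratio !qpochS -exprS => h; field.
by rewrite h hn.
Qed.

Lemma qratio0 x : qratio x 0 = 1.
Proof. by rewrite /qratio !qpoch0 divr1. Qed.

Lemma qratio_neq0 x n : (forall j, x * q ^+ j != 1) -> qratio x n != 0.
Proof. by move=> hx; rewrite mulf_neq0 ?invr_eq0 ?qpoch_q_neq0 ?qpoch_neq0. Qed.

Lemma Wwt_conserve (t2 s : F) i j k l :
  Wwt q t2 s i j k l != 0 -> (i + j = k + l)%N /\ (l <= i)%N.
Proof. by rewrite /Wwt; case: ifP => [/andP[/eqP]|]; rewrite ?eqxx. Qed.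

Lemma wwt_conserve (u s : F) i (j : bool) k (l : bool) :
  wwt q u s i j k l != 0 -> (i + j = k + l)%N.
Proof.
case: j; case: l; rewrite /= ?addn0 ?addn1; case: ifP => [/eqP ->|];
  by rewrite ?eqxx.
Qed.

(** The factor [qratio (s ^+ 2) i] cancels [(s^2;q)_i] and [(q;q)_i], and the rest of [W] splits
    into a function of [l] and a function of [i - l]. This factor is what the column contributes to
    [cfun] of the partition below the row. *)
Lemma Wwt_qratio (t2 s x : F) i j k l :
  s ^+ 2 = x * t2 -> t2 != 0 -> (forall n, s ^+ 2 * q ^+ n != 1) ->
  (i + j = k + l)%N -> (l <= i)%N ->
  qratio (s ^+ 2) i * Wwt q t2 s i j k l
  = x ^+ l * qratio t2 l * qratio x (i - l).
Proof.
move=> hs ht hg h1 h2; rewrite /Wwt h1 h2 eqxx /= /qratio.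
rewrite (_ : s ^+ 2 / t2 = x); last by rewrite hs mulfK.
have := qpoch_neq0 i hg.
have := qpoch_q_neq0 i; have := qpoch_q_neq0 l; have := qpoch_q_neq0 (i - l).
move=> h3 h4 h5 h6; field.
by rewrite h3 h4 h5 h6.
Qed.

Lemma Wwt0 (t2 s : F) : Wwt q t2 s 0 0 0 0 = 1.
Proof. by rewrite /Wwt /= !qpoch0 !(mul1r, invr1). Qed.

Lemma wwt0 (u s : F) : s * u != 1 -> wwt q u s 0 false 0 false = 1.
Proof. by move=> h; rewrite /= mulr1 divff // subr_eq0 eq_sym. Qed.

Lemma wwtM (u s : F) i (j : bool) k (l : bool) : s * u != 1 ->
  (i + j = k + l)%N ->
  wwt q u s i j k l * (1 - s * u) =
  if j then if l then s ^+ 2 * q ^+ i - s * u else 1 - s ^+ 2 * q ^+ i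
  else if l then (q ^+ i - 1) * s * u else 1 - s * u * q ^+ i.
Proof.
rewrite eq_sym -subr_eq0 => h e.
case: j e; case: l => /= e; case: ifP => [_|/eqP]; try (by rewrite divfK); lia.
Qed.

End Weights.

Section Window.
Variable F : fieldType.

(** Interlacing leaves two consecutive values for the part being summed, so the sum over a column
    has at most two terms; the first is lost when the window starts at [t.+1]. *)
Lemma big_window (G : nat -> F) (N y t : nat) :
  (forall z, G z != 0 -> z = t \/ z = t.+1) -> (y <= t.+1)%N ->
  (t.+1 <= y + N)%N ->
  \sum_(v < N.+1) G (y + v)%N = (if (y <= t)%N then G t else 0) + G t.+1.
Proof.
move=> hG h1 h2.
have hv : (t.+1 - y < N.+1)%N by lia.
rewrite (bigD1 (Ordinal hv)) //= subnKC // addrC; congr (_ + _).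
case: leqP => h3.
  have hv' : (t - y < N.+1)%N by lia.
  rewrite (bigD1 (Ordinal hv')) /=; last by rewrite -val_eqE /=; apply/eqP; lia.
  rewrite subnKC // big1 ?addr0 // => i /andP[]; rewrite -!val_eqE /= => h4 h5.
  apply: contraNeq h4 => /hG []; move/eqP: h5 => h5 h6; apply/eqP; lia.
rewrite big1 // => i; rewrite -val_eqE /= => h4.
apply: contraNeq h4 => /hG [] h6; apply/eqP; lia.
Qed.

End Window.

(** The value 0 at index -1 matches [1 / (q;q)_(-1) = 0], so that the recursions in the index also
    hold at 0. *)
Definition predval (F : fieldType) (f : nat -> F) (n : nat) : F :=
  if n is n'.+1 then f n' else 0.

Lemma gauged_neq0 (F : fieldType) (a w d b W : F) :
  a * (w * d) * b * W != 0 -> w != 0 /\ W != 0.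
Proof.
by move=> h; split; apply: contraNneq h => ->; rewrite ?(mul0r, mulr0).
Qed.

Section Path.
Variable F : fieldType.

(** Sum over weakly decreasing [X_0, ..., X_c = y] with steps at most [N]. Indexing by steps makes
    the sum finite and monotonicity automatic. The vectors [L_c] and [R_c] are of this form. *)
Fixpoint path_vec (N : nat) (T : nat -> nat -> nat -> F) (init : nat -> F)
    (c y : nat) : F :=
  if c is c'.+1 then
    \sum_(v < N.+1) path_vec N T init c' (y + v)%N * T c' (y + v)%N y
  else init y.

Lemma path_vecS_neq0 N T init c y :
  path_vec N T init c.+1 y != 0 ->
  exists X, [/\ (y <= X)%N, path_vec N T init c X != 0 & T c X y != 0].
Proof.
move=> h; apply/not_existsP => h0; move/eqP: h; apply; rewrite /= big1 // => v _.
apply/eqP/contraT => h1; case: (h0 (y + v)%N).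
by move: h1; rewrite mulf_eq0 negb_or => /andP[h1 h2]; split=> //; lia.
Qed.

End Path.

Lemma expr_divS (F : fieldType) (y : F) n : y != 0 -> y ^+ n / y ^+ n.+1 = y^-1.
Proof. by move=> y0; rewrite exprSr invfM mulrA divff ?mul1r ?expf_neq0. Qed.

(** * Column-by-column recursion for one row of each kind *)

Section Transfer.
Variables (F : fieldType) (q : F) (Xi S Xi' S' : nat -> F) (u x : F).
Hypotheses (hq0 : q != 0) (hq : forall k : nat, (0 < k)%N -> q ^+ k != 1).
Hypotheses (hXi : forall i, Xi i != 0) (hS : forall i, S i != 0).
Hypotheses (hXi' : forall i, Xi' i != 0) (hS' : forall i, S' i != 0).
Hypothesis hx : x != 0.
Hypothesis shift : forall i, Xi' i * S' i = Xi i.+1 * S i.+1.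
Hypothesis ratio : forall i, S' i / Xi' i = S i / Xi i.
Hypothesis gS : forall i j, (0 < i)%N -> S i ^+ 2 * q ^+ j != 1.
Hypothesis gS' : forall i j, (0 < i)%N -> S' i ^+ 2 * q ^+ j != 1.

Hypothesis hu : forall i, (0 < i)%N -> u * Xi i * S i != 1.

Let P i := Xi i * S i.
Let rho i := S i / Xi i.

Let SE i : S i ^+ 2 = P i * rho i.
Proof. by rewrite /P /rho; field. Qed.

Let S'E i : S' i ^+ 2 = P i.+1 * rho i.
Proof. by rewrite /P /rho -shift -ratio; field. Qed.

Let huL i : S i.+1 * (u * Xi i.+1) != 1.
Proof. by rewrite mulrC hu. Qed.

Let huR i : S' i.+1 * (u * Xi' i.+1) != 1.
Proof. by rewrite mulrC -mulrA shift mulrA hu. Qed.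

Let rho0 i : rho i != 0. Proof. by rewrite mulf_neq0 ?invr_eq0. Qed.
Let P0 i : P i != 0. Proof. by rewrite mulf_neq0. Qed.

(** [row_alpha] and [row_beta] are the two factors of [W] given by [Wwt_qratio]; [row_gamma] comes
    from [1 / cfun]. At [c = 0], [row_alpha] is the boundary weight of [FF], so the left boundary
    behaves like a column numbered 0. *)
Definition row_alpha c a : F := (x * rho c) ^+ a * qratio q (P c.+1 / x) a.
Definition row_beta c b : F := qratio q (x * rho c) b.
Definition row_gamma c k : F := (qratio q (S c ^+ 2) k)^-1.

(** With [q ^+ A / q] in place of [q ^+ A.-1], both sides vanish at [A = 0]. *)
Lemma row_alphaS c A :
  row_alpha c A * (1 - q * (q ^+ A / q))
  = predval (row_alpha c) A * rho c * (x - P c.+1 * (q ^+ A / q)).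
Proof.
have e n : q ^+ n.+1 / q = q ^+ n by rewrite exprSr mulfK.
case: A => [|A] /=; first by rewrite expr0 mul1r divff // subrr !(mulr0,mul0r).
rewrite e -exprS /row_alpha -mulrA qratioS // exprSr; field.
by rewrite hx.
Qed.

Lemma row_betaS c B :
  row_beta c B * (1 - q * (q ^+ B / q))
  = predval (row_beta c) B * (1 - x * rho c * (q ^+ B / q)).
Proof.
have e n : q ^+ n.+1 / q = q ^+ n by rewrite exprSr mulfK.
case: B => [|B] /=; first by rewrite expr0 mul1r divff // subrr !(mulr0,mul0r).
by rewrite e -exprS /row_beta qratioS.
Qed.

Lemma row_gammaS c k : (0 < c)%N ->
  row_gamma c k.+1 * (1 - S c ^+ 2 * q ^+ k) = row_gamma c k * (1 - q ^+ k.+1).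
Proof.
move=> hc; rewrite /row_gamma.
have h1 := qratio_neq0 hq k (fun j => gS j hc).
have h2 := qratio_neq0 hq k.+1 (fun j => gS j hc).
apply: (mulfI h1); apply: (mulfI h2).
transitivity (qratio q (S c ^+ 2) k * (1 - S c ^+ 2 * q ^+ k)).
  by field.
by rewrite -qratioS //; field.
Qed.

Variables (nu mu : nat -> nat).
Hypotheses (hnu : forall c, (nu c.+1 <= nu c)%N)
           (hmu : forall c, (mu c.+1 <= mu c)%N).

(* The powers of [S ^ 2] and [S' ^ 2] make the weights depend on the square
   roots only through [S i ^+ 2] and [S' i ^+ 2]; the factor [1 - s u] clears
   the denominator of [wwt]. *)
Definition transferL c X Y : F :=
  (S c.+1 ^+ 2) ^+ nu c.+1 / (S c.+1 ^+ 2) ^+ Y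
  * (wwt q (u * Xi c.+1) (S c.+1) (nu c - nu c.+1) (0 < X - nu c)%N
         (X - Y) (0 < Y - nu c.+1)%N * (1 - S c.+1 * (u * Xi c.+1)))
  * (qratio q (S' c.+1 ^+ 2) (mu c - mu c.+1) / qratio q (S c.+1 ^+ 2) (X - Y))
  * Wwt q (P c.+2 / x) (S' c.+1) (mu c - mu c.+1) (X - mu c) (X - Y)
        (Y - mu c.+1).

(** Here the summed partition lies below both rows, so its multiplicity [X - Y] is the bottom label
    of both vertices; in [transferL] it is the top label of both. *)
Definition transferR c X Y : F :=
  (S' c.+1 ^+ 2) ^+ Y / (S' c.+1 ^+ 2) ^+ mu c.+1
  * (wwt q (u * Xi' c.+1) (S' c.+1) (X - Y) (0 < mu c - X)%N
         (mu c - mu c.+1) (0 < mu c.+1 - Y)%N * (1 - S' c.+1 * (u * Xi' c.+1)))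
  * (qratio q (S' c.+1 ^+ 2) (X - Y) / qratio q (S c.+1 ^+ 2) (nu c - nu c.+1))
  * Wwt q (P c.+2 / x) (S' c.+1) (X - Y) (nu c - X) (nu c - nu c.+1)
        (nu c.+1 - Y).

Lemma transferL_supp c X Y :
  (nu c <= X <= (nu c).+1)%N -> (mu c <= X)%N -> (Y <= X)%N ->
  transferL c X Y != 0 ->
  [/\ (nu c.+1 <= Y <= (nu c.+1).+1)%N, (mu c.+1 <= Y)%N & (Y <= mu c)%N].
Proof.
move=> h1 h2 hYX; case/gauged_neq0 => /wwt_conserve h3 /Wwt_conserve [h4 h5].
have := hnu c; have := hmu c.
have e0 : ((0 < X - nu c)%N : nat) = (X - nu c)%N by case: ltnP; lia.
have e1 : ((0 < Y - nu c.+1)%N <= Y - nu c.+1)%N by case: ltnP; lia.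
have e2 : ((0 < Y - nu c.+1)%N <= 1)%N by case: ltnP; lia.
move: h3 e1 e2; rewrite e0; set b := nat_of_bool _ => h3 e1 e2 h6 h7.
split; lia.
Qed.

Lemma transferR_supp c X Y :
  (X <= mu c <= X.+1)%N -> (X <= nu c)%N -> (Y <= X)%N ->
  transferR c X Y != 0 ->
  [/\ (Y <= mu c.+1 <= Y.+1)%N, (Y <= nu c.+1)%N & (nu c.+1 <= X)%N].
Proof.
move=> h1 h2 hYX; case/gauged_neq0 => /wwt_conserve h3 /Wwt_conserve [h4 h5].
have := hnu c; have := hmu c.
have e0 : ((0 < mu c - X)%N : nat) = (mu c - X)%N by case: ltnP; lia.
have e1 : ((0 < mu c.+1 - Y)%N <= mu c.+1 - Y)%N by case: ltnP; lia.
have e2 : ((0 < mu c.+1 - Y)%N <= 1)%N by case: ltnP; lia.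
move: h3 e1 e2; rewrite e0; set b := nat_of_bool _ => h3 e1 e2 h6 h7.
split; lia.
Qed.

Lemma transferLE c X Y :
  (mu c.+1 <= Y <= mu c)%N -> (mu c <= X)%N ->
  transferL c X Y =
  (S c.+1 ^+ 2) ^+ nu c.+1 / (S c.+1 ^+ 2) ^+ Y
  * (wwt q (u * Xi c.+1) (S c.+1) (nu c - nu c.+1) (0 < X - nu c)%N
         (X - Y) (0 < Y - nu c.+1)%N * (1 - S c.+1 * (u * Xi c.+1)))
  * row_gamma c.+1 (X - Y)
  * (row_alpha c.+1 (Y - mu c.+1) * row_beta c.+1 (mu c - Y)).
Proof.
move=> /andP[h1 h2] h3; have := hmu c => h4.
rewrite /transferL /row_alpha /row_beta -/(row_gamma _ _).
rewrite (_ : (mu c - Y = mu c - mu c.+1 - (Y - mu c.+1))%N); last by lia.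
rewrite -(@Wwt_qratio _ _ hq _ (S' c.+1) _ _ (X - mu c) (X - Y)).
- by rewrite /row_gamma; ring.
- by rewrite S'E; field.
- by rewrite mulf_neq0 ?invr_eq0.
- by move=> n; apply: gS'.
- by lia.
- by lia.
Qed.

Lemma transferRE c X Y :
  (Y <= nu c.+1 <= X)%N -> (X <= nu c)%N ->
  transferR c X Y =
  (S' c.+1 ^+ 2) ^+ Y / (S' c.+1 ^+ 2) ^+ mu c.+1
  * (wwt q (u * Xi' c.+1) (S' c.+1) (X - Y) (0 < mu c - X)%N
         (mu c - mu c.+1) (0 < mu c.+1 - Y)%N * (1 - S' c.+1 * (u * Xi' c.+1)))
  * row_gamma c.+1 (nu c - nu c.+1)
  * (row_alpha c.+1 (nu c.+1 - Y) * row_beta c.+1 (X - nu c.+1)).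
Proof.
move=> /andP[h1 h2] h3; have := hnu c => h4.
rewrite /transferR /row_alpha /row_beta.
rewrite (_ : (X - nu c.+1 = X - Y - (nu c.+1 - Y))%N); last by lia.
rewrite -(@Wwt_qratio _ _ hq _ (S' c.+1) _ _ (nu c - X) (nu c - nu c.+1)).
- by rewrite /row_gamma; ring.
- by rewrite S'E; field.
- by rewrite mulf_neq0 ?invr_eq0.
- by move=> n; apply: gS'.
- by lia.
- by lia.
Qed.

Definition initL X : F :=
  if (nu 0 <= X <= (nu 0).+1)%N && (mu 0 <= X)%N then
    (S 0 ^+ 2) ^+ nu 0 / (S 0 ^+ 2) ^+ X * (- u * Xi 0 * S 0) ^+ (nu 0 < X)%N
    * row_alpha 0 (X - mu 0)
  else 0.

Definition initR X : F :=
  if (X <= mu 0 <= X.+1)%N && (X <= nu 0)%N then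
    (S' 0 ^+ 2) ^+ X / (S' 0 ^+ 2) ^+ mu 0 * (- u * Xi' 0 * S' 0) ^+ (X < mu 0)%N
    * row_alpha 0 (nu 0 - X)
  else 0.

Variable N : nat.
Hypothesis hN : (nu 0 < N)%N.

Let vecL := path_vec N transferL initL.
Let vecR := path_vec N transferR initR.

Lemma vecL_supp c y : vecL c y != 0 ->
  [/\ (nu c <= y <= (nu c).+1)%N, (mu c <= y)%N & (0 < c)%N -> (y <= mu c.-1)%N].
Proof.
elim: c y => [|c IHc] y.
  by rewrite /vecL /= /initL; case: ifP => [/andP[h1 h2]|]; rewrite ?eqxx.
case/path_vecS_neq0 => X [h1 /IHc [h2 h3 _] h4].
by case: (transferL_supp h2 h3 h1 h4) => h5 h6 h7; split.
Qed.

Lemma vecR_supp c y : vecR c y != 0 ->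
  [/\ (y <= mu c <= y.+1)%N, (y <= nu c)%N & (0 < c)%N -> (nu c <= mu c.-1)%N].
Proof.
elim: c y => [|c IHc] y.
  by rewrite /vecR /= /initR; case: ifP => [/andP[h1 h2]|]; rewrite ?eqxx.
case/path_vecS_neq0 => X [h1 /IHc [h2 h3 _] h4].
case: (transferR_supp h2 h3 h1 h4) => h5 h6 h7; split=> // _ /=; lia.
Qed.

Let nuN c : (nu c < N)%N.
Proof. by elim: c => // c; have := hnu c; lia. Qed.

Let vecL0 c y : ~~ [&& (nu c <= y <= (nu c).+1)%N, (mu c <= y)%N &
   (0 < c)%N ==> (y <= mu c.-1)%N] -> vecL c y = 0.
Proof.
apply: contraNeq => /vecL_supp [-> -> /= h]; exact/implyP.
Qed.

Let vecR0 c y : ~~ [&& (y <= mu c <= y.+1)%N, (y <= nu c)%N &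
   (0 < c)%N ==> (nu c <= mu c.-1)%N] -> vecR c y = 0.
Proof.
apply: contraNeq => /vecR_supp [-> -> /= h]; exact/implyP.
Qed.

Let qS n : q ^+ n.+1 / q = q ^+ n.
Proof. by rewrite exprSr mulfK. Qed.

Section Step.
Variable c : nat.
Hypotheses (h1 : (nu c.+1 <= mu c)%N) (h2 : (mu c.+1 <= (nu c.+1).+1)%N).
Hypothesis h3 : (mu c <= (nu c).+1)%N.

Let A := ((nu c.+1).+1 - mu c.+1)%N.
Let B := (mu c - nu c.+1)%N.
Let K := (nu c - nu c.+1)%N.
Let M := (mu c - mu c.+1)%N.
Let a := predval (row_alpha c.+1) A.
Let a1 := row_alpha c.+1 A.
Let b := row_beta c.+1 B.
Let b1 := predval (row_beta c.+1) B.
Let g := row_gamma c.+1 K.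
Let L0 := vecL c (nu c).
Let L1 := vecL c (nu c).+1.
Let R0 := vecR c (mu c).
Let R1 := predval (vecR c) (mu c).
Let w := u / rho c.+1.

Lemma vecL_step0 : vecL c.+1 (nu c.+1) =
  a * b * g * ((1 - u * P c.+1 * q ^+ K) * L0 + (1 - q * q ^+ K) * L1).
Proof.
have [h4|h4] := ltnP (nu c.+1) (mu c.+1).
  have A0 : A = 0%N by rewrite /A; lia.
  rewrite vecL0; last by rewrite (leqNgt (mu c.+1)) h4 /= !andbF.
  by rewrite /a A0 /= !mul0r.
have e1 : A = (nu c.+1 - mu c.+1).+1 by rewrite /A; lia.
have h5 := hnu c; have h6 := nuN c.
rewrite /vecL /= -/vecL (@big_window _ (fun z => vecL c z * transferL c z _) _ _ (nu c)).
- rewrite h5 mulrDr; congr (_ + _).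
    have [h7|h7] := ltnP (nu c) (mu c).
      rewrite /L0 vecL0; last by rewrite (leqNgt (mu c)) h7 /= !andbF.
      by rewrite !(mulr0, mul0r).
    rewrite transferLE ?h1 ?h4 // divff ?expf_neq0 // mul1r !subnn ltnn.
    rewrite wwtM // -/L0 -/K -/B -/g /a e1 /= -/b /P; ring.
  rewrite transferLE ?h1 ?h4 //.
  rewrite divff ?expf_neq0 // mul1r !subnn ltnn subSn // subnn subSn //.
  rewrite wwtM //; last by rewrite /=; lia.
  rewrite /= -/L1 -/K -/B -/b.
  (* The vertex absorbing the horizontal path has numerator [1 - s^2 q^K], exactly what lowers
     [row_gamma] from [K.+1] to [K]. *)
  have := row_gammaS K (ltn0Sn c); rewrite -/g [q ^+ _.+1]exprS => h8.
  rewrite /a e1 /=.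
  transitivity (row_alpha c.+1 (nu c.+1 - mu c.+1) * b
     * (row_gamma c.+1 K.+1 * (1 - S c.+1 ^+ 2 * q ^+ K)) * L1).
    by ring.
  by rewrite h8; ring.
- move=> z; rewrite mulf_eq0 negb_or => /andP[/vecL_supp [h7 _ _] _]; lia.
- lia.
- lia.
Qed.

Lemma vecL_step1 : vecL c.+1 (nu c.+1).+1 =
  a1 * b1 * g * (- w * (1 - P c.+1 * rho c.+1 * (q ^+ K / q)) * L0
                 + (q ^+ K - w) * L1).
Proof.
have h5 := hnu c; have h6 := nuN c.
have [h4|h4] := leqP (mu c) (nu c.+1).
  have B0 : B = 0%N by rewrite /B; lia.
  rewrite vecL0; last by apply/negP => /and3P[_ _ /= h7]; lia.
  by rewrite /b1 B0 /= !(mul0r, mulr0).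
have e1 : B = (mu c - (nu c.+1).+1).+1 by rewrite /B; lia.
(* Since [Y] exceeds [nu c.+1] by one, a gauge factor [S ^- 2] is left over; it turns [u * P c.+1]
   into [w]. *)
have wE : w * S c.+1 ^+ 2 = u * P c.+1.
  by rewrite /w SE /P; field.
have S2 : S c.+1 ^+ 2 != 0 by rewrite expf_neq0.
have S2E : (S c.+1 ^+ 2) ^+ nu c.+1 / (S c.+1 ^+ 2) ^+ (nu c.+1).+1
           = (S c.+1 ^+ 2)^-1.
  exact: expr_divS.
rewrite /vecL /= -/vecL (@big_window _ (fun z => vecL c z * transferL c z _) _ _ (nu c)).
- rewrite mulrDr; congr (_ + _).
    have [h7|h7] := ltnP (nu c) (mu c).
      rewrite /L0 vecL0; last by rewrite (leqNgt (mu c)) h7 /= !andbF.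
      by rewrite !(mulr0, mul0r) if_same.
    case: ifP => h8; last by lia.
    rewrite transferLE ?h2 ?h4 // S2E !subnn ltnn subSn // subnn.
    rewrite wwtM //; last by rewrite /=; lia.
    have eK : K = (nu c - (nu c.+1).+1).+1 by rewrite /K; lia.
    have := row_gammaS (nu c - (nu c.+1).+1) (ltn0Sn c).
    rewrite -eK -/g => h9.
    rewrite -/L0 -/K (_ : q ^+ K / q = q ^+ (nu c - (nu c.+1).+1)); last by rewrite eK qS.
    rewrite /b1 e1 /a1 /A.
    transitivity (- row_alpha c.+1 ((nu c.+1).+1 - mu c.+1)
      * row_beta c.+1 (mu c - (nu c.+1).+1) * w * L0 *
      (row_gamma c.+1 (nu c - (nu c.+1).+1) * (1 - q ^+ K))).
      apply: (mulfI S2).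
      transitivity (L0 * ((q ^+ K - 1) * (u * P c.+1)) *
        row_gamma c.+1 (nu c - (nu c.+1).+1) *
        (row_alpha c.+1 ((nu c.+1).+1 - mu c.+1)
        * row_beta c.+1 (mu c - (nu c.+1).+1))).
        by rewrite /P /=; field.
      by rewrite -wE; ring.
    by rewrite -h9 -SE /=; ring.
  rewrite transferLE ?h2 ?h4 // S2E subSn // subnn subSS subSn // subnn.
  rewrite wwtM //= -/L1 -/K -/g /b1 e1 /a1 /A /=.
  apply: (mulfI S2).
  transitivity (L1 * (S c.+1 ^+ 2 * q ^+ K - u * P c.+1) * g *
       (row_alpha c.+1 ((nu c.+1).+1 - mu c.+1)
        * row_beta c.+1 (mu c - (nu c.+1).+1))).
    by rewrite /P /=; field.
  by rewrite -wE; ring.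
- move=> z; rewrite mulf_eq0 negb_or => /andP[/vecL_supp [h7 _ _] _]; lia.
- lia.
- lia.
Qed.
Let S'2 : S' c.+1 ^+ 2 != 0. Proof. by rewrite expf_neq0. Qed.

Let wER : w * S' c.+1 ^+ 2 = S' c.+1 * (u * Xi' c.+1).
Proof. by rewrite /w S'E /P -shift; field. Qed.

Let PE : P c.+2 = S' c.+1 * Xi' c.+1.
Proof. by rewrite /P -shift mulrC. Qed.

(** The window is [mu c - 1], [mu c]. [predval] covers [mu c = 0], and the test [y <= z] discards
    the lower value when it falls below [y]. *)
Lemma vecR_bigE y : (mu c.+1 <= y.+1)%N -> (y <= mu c.+1)%N ->
  vecR c.+1 y = R0 * transferR c (mu c) y
    + predval (fun z => if (y <= z)%N then vecR c z * transferR c z y else 0)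
              (mu c).
Proof.
move=> h4 h5; have h6 := hmu c; have h7 := nuN c.
rewrite /vecR /= -/vecR /R0.
case e : (mu c) => [|m] /=.
  have -> : y = 0%N by lia.
  rewrite addr0 (bigD1 ord0) //= addn0 big1 ?addr0 // => -[i hi] /=.
  rewrite add0n -val_eqE /= => i0; rewrite vecR0 ?mul0r //.
  by apply/negP => /and3P[]; rewrite e; lia.
rewrite (@big_window _ (fun z => vecR c z * transferR c z _) _ _ m).
- by rewrite addrC.
- move=> z; rewrite mulf_eq0 negb_or => /andP[/vecR_supp [h8 _ _] _]; lia.
- lia.
- lia.
Qed.

Lemma vecR_step0 : vecR c.+1 (mu c.+1) =
  a * g * (b * (1 - u * P c.+2 * q ^+ M) * R0
           + (1 - P c.+2 * rho c.+1 * (q ^+ M / q)) * (b1 * R1)).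
Proof.
have h5 := hmu c; have h6 := hnu c.
have [h4|h4] := ltnP (nu c.+1) (mu c.+1).
  have A0 : A = 0%N by rewrite /A; lia.
  rewrite vecR0; last by apply/negP => /and3P[_ h7 _]; lia.
  by rewrite /a A0 /= !mul0r.
have e1 : A = (nu c.+1 - mu c.+1).+1 by rewrite /A; lia.
rewrite vecR_bigE // mulrDr; congr (_ + _).
  have [h7|h7] := ltnP (nu c) (mu c).
    rewrite /R0 vecR0; last by apply/negP => /and3P[_ h8 _]; lia.
    by rewrite !(mulr0, mul0r).
  rewrite transferRE ?h1 ?h4 // divff ?expf_neq0 // mul1r !subnn ltnn.
  rewrite wwtM // -/K -/B -/M -/g -/b /a e1 /= PE; ring.
(* If [B = 0] then [mu c = nu c.+1], and the value [mu c - 1] violates interlacing with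
   [nu c.+1]. *)
rewrite /R1 /b1; case e2 : B => [|B'] /=.
  rewrite !(mul0r, mulr0); case e : (mu c) => [//|m] /=.
  case: ifP => // h7; apply/eqP/contraT; rewrite mulf_eq0 negb_or.
  case/andP=> /vecR_supp [h8 h9 _] h10.
  have [_ _] := transferR_supp h8 h9 h7 h10.
  by move: e2; rewrite /B; lia.
have e : mu c = (mu c).-1.+1 by move: e2; rewrite /B; lia.
rewrite e /=; set m := (mu c).-1.
have h7 : (mu c.+1 <= m)%N by move: e2; rewrite /B; lia.
have h8 : (m - nu c.+1 = B')%N by move: e2; rewrite /B; lia.
have h9 : (0 < mu c - m)%N by lia.
have h10 : (m <= nu c)%N by lia.
have h11 : (nu c.+1 <= m)%N by move: e2; rewrite /B; lia.
have eM : M = (m - mu c.+1).+1 by rewrite /M; lia.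
rewrite h7 transferRE ?h4 //.
rewrite divff ?expf_neq0 // mul1r subnn ltnn h9.
rewrite -/M -/K -/g wwtM //=; last by lia.
by rewrite eM qS -S'E /a e1 /= h8; ring.
Qed.

Lemma vecR_step1 : (0 < mu c.+1)%N -> vecR c.+1 (mu c.+1).-1 =
  a1 * g * (b * (q * q ^+ M - 1) * w * R0 + (q ^+ M - w) * (b1 * R1)).
Proof.
move=> h0; have h5 := hmu c; have h6 := hnu c.
set y := (mu c.+1).-1; have ey : mu c.+1 = y.+1 by rewrite /y; lia.
have eA : (nu c.+1 - y = A)%N by rewrite /A; lia.
have S2E : (S' c.+1 ^+ 2) ^+ y / (S' c.+1 ^+ 2) ^+ mu c.+1 = (S' c.+1 ^+ 2)^-1.
  by rewrite ey expr_divS.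
have h4 : (y <= nu c.+1)%N by lia.
have h12 : (0 < mu c.+1 - y)%N by lia.
rewrite vecR_bigE; [|by lia|by lia].
rewrite mulrDr; congr (_ + _).
  have [h7|h7] := ltnP (nu c) (mu c).
    rewrite /R0 vecR0; last by apply/negP => /and3P[_ h8 _]; lia.
    by rewrite !(mulr0, mul0r).
  rewrite transferRE ?h1 ?h4 // S2E subnn ltnn h12.
  have eM : (mu c - y = M.+1)%N by rewrite /M; lia.
  rewrite wwtM //; last by rewrite eM /= /M; lia.
  rewrite eM eA -/K -/B -/g -/b -/a1 /=.
  apply: (mulfI S'2).
  transitivity (R0 * ((q ^+ M.+1 - 1) * (S' c.+1 * (u * Xi' c.+1)) * g * (a1 * b))).
    by field.
  by rewrite -wER exprS; ring.
rewrite /R1 /b1; case e2 : B => [|B'] /=.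
  rewrite !(mul0r, mulr0); case e : (mu c) => [//|m] /=.
  case: ifP => // h7; apply/eqP/contraT; rewrite mulf_eq0 negb_or.
  case/andP=> /vecR_supp [h8 h9 _] h10.
  have [_ _] := transferR_supp h8 h9 h7 h10.
  by move: e2; rewrite /B; lia.
have e : mu c = (mu c).-1.+1 by move: e2; rewrite /B; lia.
rewrite e /=; set m := (mu c).-1.
have h7 : (y <= m)%N by move: e2; rewrite /B; lia.
have h8 : (m - nu c.+1 = B')%N by move: e2; rewrite /B; lia.
have h9 : (0 < mu c - m)%N by lia.
have h10 : (m <= nu c)%N by lia.
have h11 : (nu c.+1 <= m)%N by move: e2; rewrite /B; lia.
have eM : (m - y = M)%N by rewrite /M; lia.
rewrite h7 transferRE ?h4 //.
rewrite S2E h9 h12 eM eA -/M -/K -/g -/a1 h8 wwtM //=.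
apply: (mulfI S'2).
transitivity (vecR c m * (S' c.+1 ^+ 2 * q ^+ M - S' c.+1 * (u * Xi' c.+1)) * g
   * (a1 * row_beta c.+1 B')).
  by field.
by rewrite -wER; ring.
Qed.
End Step.

(* For [k = nu c - mu c], the exponent [k + 1] is the natural number
   [(nu c).+1 - mu c], and [z] is [q ^ k] also when [k = -1]. *)
Lemma transfer_relation c : (mu c <= (nu c).+1)%N ->
  let z := q ^+ ((nu c).+1 - mu c) / q in
  (1 - u * x) * vecR c (mu c)
    = (1 - u * P c.+1 * z) * vecL c (nu c) + (1 - q * z) * vecL c (nu c).+1
  /\ ((0 < mu c)%N -> (1 - u * x) * vecR c (mu c).-1
    = - u * (x - P c.+1 * z) * vecL c (nu c)
      + (q * z - u * x) * vecL c (nu c).+1).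
Proof.
elim: c => [|c IHc] h2 z.
  set A := ((nu 0).+1 - mu 0)%N.
  pose a := predval (row_alpha 0) A; pose a1 := row_alpha 0 A.
  have Sgauge (s : F) (s0 : s != 0) n : (s ^+ 2) ^+ n / (s ^+ 2) ^+ n.+1 = (s ^+ 2)^-1.
    by apply: expr_divS; rewrite expf_neq0.
  have eL0 : vecL 0 (nu 0) = a.
    rewrite /vecL /= /initL leqnn leqnSn ltnn /= /a /A.
    case: leqP => h.
      by rewrite subSn // divff ?expf_neq0 // expr0 !mul1r.
    by rewrite (_ : (_ - _ = 0)%N) //; lia.
  have eL1 : vecL 0 (nu 0).+1 = - (u / rho 0) * a1.
    rewrite /vecL /= /initL leqnn leqnSn h2 /= Sgauge // /a1 -/A /rho expr1.
    by field; rewrite hXi hS.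
  have eR0 : vecR 0 (mu 0) = a.
    rewrite /vecR /= /initR leqnn leqnSn ltnn /= /a /A.
    case: leqP => h.
      by rewrite subSn // divff ?expf_neq0 // expr0 !mul1r.
    by rewrite (_ : (_ - _ = 0)%N) //; lia.
  have eR1 : (0 < mu 0)%N -> vecR 0 (mu 0).-1 = - (u / rho 0) * a1.
    move=> h; rewrite /vecR /= /initR prednK // leqnn leq_pred.
    have -> : ((mu 0).-1 <= nu 0)%N by lia.
    have -> : (nu 0 - (mu 0).-1 = A)%N by rewrite /A; lia.
    rewrite -{2}(prednK h) Sgauge // /a1 /rho -ratio /= expr1.
    by field; rewrite hXi' hS'.
  (* Before any column the two vectors have the same two entries, so both relations reduce to the
     recursion of the boundary weight. *)
  have := row_alphaS 0 A; rewrite -/z -/a -/a1 => hA.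
  rewrite eL0 eL1 eR0; split=> [|/eR1 ->].
    rewrite (_ : (1 - q * z) * _ = - (u / rho 0) * (a1 * (1 - q * z))); last by ring.
    by rewrite hA; field.
  rewrite (_ : - u * (x - P 1 * z) * a = - (u / rho 0) * (a * rho 0 * (x - P 1 * z))).
    by rewrite -hA; ring.
  by field.
(* If [mu] and [nu] are not close enough to interlace with a common partition, both vectors
   vanish. *)
have [h3|h3] := leqP (mu c) (nu c).+1; last first.
  have L0 y : vecL c.+1 y = 0.
    apply/eqP/contraT => /path_vecS_neq0 [X [_ /vecL_supp [h4 h5 _] _]]; lia.
  have R0 y : vecR c.+1 y = 0.
    apply/eqP/contraT => /path_vecS_neq0 [X [_ /vecR_supp [h4 h5 _] _]]; lia.
  by rewrite !L0 !R0 !mulr0 addr0.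
have [h1|h1] := leqP (nu c.+1) (mu c); last first.
  have L0 y : vecL c.+1 y = 0.
    by apply/vecL0/negP => /and3P[/= h4 _ h5]; lia.
  have R0 y : vecR c.+1 y = 0.
    by apply/vecR0/negP => /and3P[/= _ _ h5]; lia.
  by rewrite !L0 !R0 !mulr0 addr0.
have [H0 H1] := IHc h3; set y := q ^+ _ / q in H0 H1.
rewrite vecL_step0 // vecL_step1 // vecR_step0 //.
set A := ((nu c.+1).+1 - mu c.+1)%N in z *.
set B := (mu c - nu c.+1)%N.
set w := u / rho c.+1.
have uE : u = w * rho c.+1 by rewrite /w divfK.
(* The multiplicities of [nu] and [mu] are [k_c + B] and [k_(c+1) + B], so [y], [z] and [q ^+ B / q]
   express every power of [q] that occurs. *)
have eK : q ^+ (nu c - nu c.+1) = y * (q * (q ^+ B / q)).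
  have -> : y * (q * (q ^+ B / q)) = q ^+ ((nu c).+1 - mu c + B) / q.
    by rewrite exprD /y; field.
  have -> : ((nu c).+1 - mu c + B = (nu c - nu c.+1).+1)%N.
    by rewrite /B; have := hnu c; lia.
  by rewrite qS.
have eM : q ^+ (mu c - mu c.+1) = z * (q * (q ^+ B / q)).
  have -> : z * (q * (q ^+ B / q)) = q ^+ (A + B) / q.
    by rewrite exprD /z; field.
  have -> : (A + B = (mu c - mu c.+1).+1)%N.
    by rewrite /A /B; have := hmu c; lia.
  by rewrite qS.
have eKq : q ^+ (nu c - nu c.+1) / q = y * (q ^+ B / q).
  by rewrite eK; field.
have eMq : q ^+ (mu c - mu c.+1) / q = z * (q ^+ B / q).
  by rewrite eM; field.
rewrite eKq eMq eK eM.
have Ha := row_alphaS c.+1 A; have Hb := row_betaS c.+1 B.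
(* The second relation is only known for [mu c > 0]; if [mu c = 0] then [B = 0] and the factor in
   front vanishes. *)
have H1' : predval (row_beta c.+1) B * ((1 - u * x) * predval (vecR c) (mu c)) =
   predval (row_beta c.+1) B * (- u * (x - P c.+1 * y) * vecL c (nu c)
     + (q * y - u * x) * vecL c (nu c).+1).
  have [h4|h4] := posnP (mu c).
    by rewrite /B h4 sub0n /= !mul0r.
  by rewrite -(H1 h4); case: (mu c) h4.
have := @exchange_local F q w x (rho c.+1) (P c.+1) (P c.+2) y z (q ^+ B / q)
  (row_beta c.+1 B) (predval (row_beta c.+1) B)
  (predval (row_alpha c.+1) A) (row_alpha c.+1 A)
  (row_gamma c.+1 (nu c - nu c.+1)) (vecL c (nu c)) (vecL c (nu c).+1)
  (vecR c (mu c)) (predval (vecR c) (mu c)).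
rewrite -uE => /(_ Ha Hb H0 H1') [E0 E1].
split.
  by rewrite -E0; congr (_ * _); ring.
move=> h4; rewrite vecR_step1 //; rewrite -E1 -/A -/B -/w eM; congr (_ * _); ring.
Qed.

End Transfer.

(** * Partitions in a box *)

Section Partitions.
Local Open Scope nat_scope.
Implicit Types la mu : intpart.

Lemma part_eq0 la i : size la < i -> part la i = 0.
Proof. by case: i => // i h; rewrite /part nth_default. Qed.

Lemma intpart_gt0 la i : 0 < i -> (0 < part la i) = (i <= size la).
Proof.
case: i => // i _; rewrite /part /=.
have [h|h] := ltnP i (size la); last by rewrite nth_default.
have /andP[_ h0] := intpartP la; rewrite lt0n; apply: contraNneq h0 => <-.
exact: mem_nth.
Qed.

Lemma part_anti la i : 0 < i -> part la i.+1 <= part la i.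
Proof.
case: i => // i _; rewrite /part /=.
have /andP[/(sortedP 0) h _] := intpartP la.
by case: (ltnP i.+1 (size la)) => [/h //|h1]; rewrite (nth_default _ h1).
Qed.

Lemma part_le1 la i : 0 < i -> part la i <= part la 1.
Proof.
elim: i => // -[|i] IHi _ //; exact: leq_trans (part_anti _ _) (IHi _).
Qed.

Lemma intpart_ext la mu : (forall i, 0 < i -> part la i = part mu i) -> la = mu.
Proof.
move=> h; apply: val_inj => /=.
have hs : size la = size mu.
  apply/eqP; rewrite eqn_leq; apply/andP; split; rewrite leqNgt; apply/negP => hs.
    have := intpart_gt0 la (ltn0Sn (size mu)).
    by rewrite hs h // part_eq0.
  have := intpart_gt0 mu (ltn0Sn (size la)).
  by rewrite hs -h // part_eq0.
by apply: (@eq_from_nth _ 0 _ _ hs) => i _; apply: (h i.+1).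
Qed.

Lemma mconjE la i : mconj la i = part la i - part la i.+1.
Proof. by []. Qed.

Definition trim (s : seq nat) : seq nat := take (find (pred1 0) s) s.

Lemma trim_intpart s : sorted geq s -> is_intpart (trim s).
Proof.
move=> hs; rewrite /is_intpart take_sorted //=.
apply/negP => /(nthP 0) [i]; rewrite size_take_min leq_min => /andP[h _].
by rewrite nth_take // => /eqP; apply/negP; have := before_find 0 h => /= ->.
Qed.

Lemma nth_trim s i : sorted geq s -> nth 0 (trim s) i = nth 0 s i.
Proof.
move=> hs; rewrite /trim; have [h|h] := ltnP i (find (pred1 0) s).
  by rewrite nth_take.
rewrite nth_default; last by rewrite size_take_min; lia.
have [h1|h1] := ltnP i (size s); last by rewrite nth_default.
have hz : has (pred1 0) s by rewrite has_find (leq_ltn_trans h).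
have /eqP e := nth_find 0 hz.
apply/esym/eqP; rewrite -leqn0 -{2}e.
have gt : transitive geq by move=> a b c /= h2 h3; apply: leq_trans h3 h2.
apply: (sorted_leq_nth gt _ 0 hs) => //; rewrite ?inE //; last by rewrite -has_find.
by move=> a /=.
Qed.

Section Box.
Variables L N : nat.

(* [x] lists the multiplicities of the conjugate partition. *)
Definition tailsum (x : {ffun 'I_L -> 'I_N.+1}) (c : nat) : nat :=
  \sum_(i < L | c <= i) x i.

Lemma tailsum_anti x c : tailsum x c.+1 <= tailsum x c.
Proof.
rewrite /tailsum big_mkcond [X in _ <= X]big_mkcond /=; apply: leq_sum => i _.
by case: ltnP => [/ltnW -> //|].
Qed.

Lemma tailsum_ord x (c : 'I_L) : tailsum x c = x c + tailsum x c.+1.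
Proof.
rewrite /tailsum (bigD1 c) //=; congr (_ + _); apply: eq_bigl => i.
by rewrite -val_eqE /=; lia.
Qed.

Lemma tailsum_ge x c : L <= c -> tailsum x c = 0.
Proof. by move=> h; rewrite /tailsum big_pred0 // => i; have := ltn_ord i; lia. Qed.

Lemma sorted_tailsum x : sorted geq (mkseq (tailsum x) L).
Proof.
apply/(sortedP 0) => i; rewrite size_mkseq => h.
rewrite !nth_mkseq //; first exact: tailsum_anti.
exact: ltn_trans h.
Qed.

(** In these coordinates, which are also the vertical labels, a sum over partitions is an
    unconstrained finite sum and can be done one column at a time. *)
Definition boxpart (x : {ffun 'I_L -> 'I_N.+1}) : intpart :=
  IntPart (trim_intpart (sorted_tailsum x)).

Lemma part_boxpart x c : part (boxpart x) c.+1 = tailsum x c.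
Proof.
rewrite /part /= nth_trim; last exact: sorted_tailsum.
have [h|h] := ltnP c L; first by rewrite nth_mkseq.
by rewrite nth_default ?size_mkseq // tailsum_ge.
Qed.

Lemma mconj_boxpart x (c : 'I_L) : mconj (boxpart x) c.+1 = x c.
Proof. by rewrite mconjE !part_boxpart tailsum_ord addnK. Qed.

Lemma boxpart_inj : injective boxpart.
Proof.
move=> x y h; apply/ffunP => c; apply/val_inj => /=.
by have := mconj_boxpart y c; rewrite -h mconj_boxpart.
Qed.

Definition boxidx la : {ffun 'I_L -> 'I_N.+1} := [ffun c : 'I_L => inord (mconj la c.+1)].

Lemma boxidxK la : size la <= L -> (forall c, 0 < c -> mconj la c <= N) ->
  boxpart (boxidx la) = la.
Proof.
move=> hL hN; apply: intpart_ext => -[//|c] _; rewrite part_boxpart.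
have [h|h] := leqP L c; first by rewrite tailsum_ge // part_eq0 //; lia.
(* Descending induction on [c], starting from the zero parts beyond [L]. *)
rewrite -(subKn (ltnW h)); move: (L - c) (leq_subr c L) => k.
elim: k => [|k IHk] hk; first by rewrite subn0 tailsum_ge // part_eq0 //; lia.
have hc : L - k.+1 < L by lia.
rewrite (tailsum_ord _ (Ordinal hc)) /=.
have e : (L - k.+1).+1 = L - k by lia.
rewrite e IHk; last by lia.
rewrite ffunE inordK /=; last by rewrite ltnS hN.
rewrite mconjE e; have hp : 0 < L - k by lia.
by have := part_anti la hp; lia.
Qed.

Lemma size_boxpart x : size (boxpart x) <= L.
Proof.
rewrite leqNgt; apply/negP => h.
by have := intpart_gt0 (boxpart x) (ltn0Sn L); rewrite h part_boxpart tailsum_ge.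
Qed.

End Box.
End Partitions.

Section Sums.
Variable R : nmodType.

Definition ffcons (T : Type) n (x : T) (k : {ffun 'I_n -> T}) : {ffun 'I_n.+1 -> T} :=
  [ffun i => oapp k x (unlift ord0 i)].

Lemma ffcons0 T n (x : T) (k : {ffun 'I_n -> T}) : ffcons x k ord0 = x.
Proof. by rewrite ffunE unlift_none. Qed.

Lemma ffconsS T n (x : T) (k : {ffun 'I_n -> T}) i :
  ffcons x k (lift ord0 i) = k i.
Proof. by rewrite ffunE liftK. Qed.

Lemma big_ffcons (T : finType) n (G : {ffun 'I_n.+1 -> T} -> R) :
  \sum_k G k = \sum_x \sum_(k : {ffun 'I_n -> T}) G (ffcons x k).
Proof.
rewrite pair_big /=.
rewrite (reindex (fun p : T * {ffun 'I_n -> T} => ffcons p.1 p.2)) //=.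
exists (fun k : {ffun 'I_n.+1 -> T} => (k ord0, [ffun i => k (lift ord0 i)])).
  move=> [x k] _ /=; rewrite ffcons0; congr pair.
  by apply/ffunP => i; rewrite ffunE ffconsS.
move=> k _; apply/ffunP => i /=.
by case: (unliftP ord0 i) => [j ->|->]; rewrite ?ffcons0 // ffconsS ffunE.
Qed.

End Sums.

(** Summing over the first coordinate applies one transfer, so removing a column advances [c] by
    one. The tail sums are the parts, offset by the final value [y]. *)
Lemma path_vec_sum (F : fieldType) (N L : nat) (T : nat -> nat -> nat -> F)
    (init : nat -> F) c y :
  \sum_(x : {ffun 'I_L -> 'I_N.+1})
     path_vec N T init c (y + tailsum x 0)%N
     * \prod_(i < L) T (c + i)%N (y + tailsum x i)%N (y + tailsum x i.+1)%N
  = path_vec N T init (c + L) y.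
Proof.
elim: L c y => [|L IHL] c y.
  rewrite addn0 (bigD1 [ffun=> ord0]) //= big_ord0 mulr1 tailsum_ge // addn0.
  rewrite big1 ?addr0 // => x /eqP []; apply/ffunP => -[]; first by [].
rewrite big_ffcons exchange_big /= addnS -addSn -IHL; apply: eq_bigr => x _ /=.
have e0 v : tailsum (ffcons v x) 0 = (v + tailsum x 0)%N.
  rewrite /tailsum big_mkcond [X in (_ + X)%N]big_mkcond big_ord_recl /= ffcons0.
  by congr (_ + _)%N; apply: eq_bigr => i _; rewrite ffconsS.
have eS v i : tailsum (ffcons v x) i.+1 = tailsum x i.
  rewrite /tailsum big_mkcond [RHS]big_mkcond big_ord_recl /= add0n.
  by apply: eq_bigr => j _; rewrite ffconsS /bump leq0n add1n ltnS.
rewrite big_distrl /=; apply: eq_bigr => v _.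
rewrite big_ord_recl /= mulrA addn0 !e0 eS addnCA [(v + _)%N]addnC.
congr (_ * _); apply: eq_bigr => i _.
by rewrite /bump leq0n add1n !eS addnS addSn.
Qed.

(** * One-row kernels *)

Definition subpart (mu la : intpart) : Prop :=
  forall i, (0 < i)%N -> (part mu i <= part la i)%N.

Lemma subpart_size mu la : subpart mu la -> (size mu <= size la)%N.
Proof.
move=> h; case: (posnP (size mu)) => [-> //|h0].
have h1 : (0 < part mu (size mu))%N by rewrite intpart_gt0.
by rewrite -(intpart_gt0 la h0) (leq_trans h1) // h.
Qed.

Section RowWeight.
Variables (F : fieldType) (H : Type) (hof : nat -> H) (hval : H -> nat).
Variable wt : nat -> nat -> H -> nat -> H -> F.
Hypothesis hof0 : hval (hof 0) = 0%N.
Hypothesis conserve : forall c i j k l,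
  wt c i j k l != 0 -> (i + hval j = k + hval l)%N.

(** Conservation forces each horizontal label to be a difference of parts; [hof] encodes it in
    [bool] or [nat], so that both kinds of rows are treated together. *)
Definition row_weight (L : nat) (la mu : intpart) : F :=
  \prod_(c < L) wt c.+1 (mconj mu c.+1) (hof (part la c.+1 - part mu c.+1))
                        (mconj la c.+1) (hof (part la c.+2 - part mu c.+2)).

(** Subtraction truncates and [hof] may lose information (2 becomes [true]). Conservation excludes
    both, column by column from the empty right end. *)
Lemma row_weight_supp L (la mu : intpart) :
  (size la <= L)%N -> (size mu <= L)%N -> row_weight L la mu != 0 ->
  subpart mu la /\ forall i, (0 < i)%N ->
    hval (hof (part la i - part mu i)) = (part la i - part mu i)%N.
Proof.
move=> hla hmu; rewrite /row_weight prodf_seq_neq0 => /allP h.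
suff hc c : (part mu c.+1 <= part la c.+1)%N /\
    hval (hof (part la c.+1 - part mu c.+1)) = (part la c.+1 - part mu c.+1)%N.
  by split=> -[|i] // _; case: (hc i).
have big d : (L <= d)%N -> (part mu d.+1 <= part la d.+1)%N /\
    hval (hof (part la d.+1 - part mu d.+1)) = (part la d.+1 - part mu d.+1)%N.
  by move=> hd; rewrite !part_eq0 //; lia.
have [/big //|hcL] := leqP L c.
rewrite -(subKn (ltnW hcL)); move: (L - c)%N (leq_subr c L) => k.
elim: k => [|k IHk] hk; first by apply: big; lia.
have hk' : (L - k.+1 < L)%N by lia.
have e : ((L - k.+1).+1 = L - k)%N by lia.
have /conserve := h (Ordinal hk') (mem_index_enum _).
have [h1 h2] := IHk (ltnW hk).
rewrite /= !mconjE e h2.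
have hp : (0 < L - k)%N by lia.
have := part_anti la hp; have := part_anti mu hp.
move: h1; have [h3|h3] := leqP (part mu (L - k)) (part la (L - k)); first by lia.
by rewrite (_ : (part la (L - k) - part mu (L - k) = 0)%N) ?hof0; lia.
Qed.

Lemma row_weight_neq0 L (la mu : intpart) c :
  (c < L)%N -> row_weight L la mu != 0 ->
  wt c.+1 (mconj mu c.+1) (hof (part la c.+1 - part mu c.+1))
     (mconj la c.+1) (hof (part la c.+2 - part mu c.+2)) != 0.
Proof.
move=> hc; rewrite /row_weight prodf_seq_neq0 => /allP h.
exact: (h (Ordinal hc) (mem_index_enum _)).
Qed.

Lemma row_weight_widen L L' (la mu : intpart) :
  (forall c, wt c.+1 0 (hof 0) 0 (hof 0) = 1) ->
  (size la <= L)%N -> (size mu <= L)%N -> (L <= L')%N ->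
  row_weight L' la mu = row_weight L la mu.
Proof.
clear hof0 conserve; move=> h1 hla hmu /subnKC <-.
rewrite /row_weight big_split_ord /=.
rewrite [X in _ * X]big1 ?mulr1 // => c _.
by rewrite !mconjE !part_eq0 ?subnn ?h1 //; lia.
Qed.

End RowWeight.

Section Kernels.
Variables (F : fieldType) (q : F).
Hypotheses (hq : forall k : nat, (0 < k)%N -> q ^+ k != 1).

Definition pos_nat (n : nat) : bool := (0 < n)%N.

Definition Fkernel (u : F) (Xi S : nat -> F) (L : nat) (la nu : intpart) : F :=
  (- u * Xi 0 * S 0) ^+ pos_nat (part la 1 - part nu 1)
  * row_weight pos_nat (fun c => wwt q (u * Xi c) (S c)) L la nu.

Definition Gkernel (kappa rho0 : F) (t2 S' : nat -> F) (L : nat)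
    (la mu : intpart) : F :=
  (kappa * rho0) ^+ (part la 1 - part mu 1)
  * qratio q (t2 0) (part la 1 - part mu 1)
  * row_weight id (fun c => Wwt q (t2 c) (S' c)) L la mu.

Lemma Fkernel_supp u Xi S L (la nu : intpart) :
  (size la <= L)%N -> (size nu <= L)%N -> Fkernel u Xi S L la nu != 0 ->
  subpart nu la /\ forall i, (0 < i)%N -> (part la i <= (part nu i).+1)%N.
Proof.
move=> hla hnu; rewrite mulf_eq0 negb_or => /andP[_ h].
have hc c i j k l : wwt q (u * Xi c) (S c) i j k l != 0 -> (i + j = k + l)%N.
  exact: wwt_conserve.
have [h1 h2] := @row_weight_supp F _ pos_nat nat_of_bool _ erefl hc _ _ _ hla hnu h.
split=> // i /h2; rewrite /pos_nat; case: ltnP; lia.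
Qed.

(** [W] requires the right label to be at most the bottom one. In the first column past the parts of
    [mu] the bottom label is 0, so nothing passes further. *)
Lemma Gkernel_supp kappa rho0 t2 S' L (la mu : intpart) :
  (size la <= L)%N -> (size mu <= L)%N -> Gkernel kappa rho0 t2 S' L la mu != 0 ->
  subpart mu la /\ (size la <= (size mu).+1)%N.
Proof.
move=> hla hmu; rewrite mulf_eq0 negb_or => /andP[_ h].
have hc c i j k l : Wwt q (t2 c) (S' c) i j k l != 0 -> (i + j = k + l)%N.
  by case/Wwt_conserve.
have [h1 h2] := @row_weight_supp F _ id id _ erefl hc _ _ _ hla hmu h.
split=> //; rewrite leqNgt; apply/negP => h3.
have hL : (size mu < L)%N by lia.
have [_] := Wwt_conserve (row_weight_neq0 hL h).
have := intpart_gt0 la (ltn0Sn (size mu).+1); rewrite h3.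
by rewrite mconjE (@part_eq0 mu (size mu).+1) // (@part_eq0 mu (size mu).+2) //; lia.
Qed.

Lemma powSE (S : nat -> F) L (la : intpart) : (size la <= L)%N ->
  powS S la = \prod_(c < L) (- S c) ^+ part la c.+1.
Proof.
move=> /subnKC <-; rewrite big_split_ord /= [X in _ * X]big1 ?mulr1.
  by rewrite /powS big_add1 big_mkord.
by move=> c _; rewrite part_eq0 ?expr0 //; lia.
Qed.

Lemma cfunE (S : nat -> F) L (la : intpart) : (size la <= L)%N ->
  cfun q S la = \prod_(c < L) qratio q (S c.+1 ^+ 2) (mconj la c.+1).
Proof.
move=> /subnKC <-; rewrite big_split_ord /= [X in _ * X]big1 ?mulr1.
  by rewrite /cfun big_add1 big_mkord.
by move=> c _; rewrite mconjE !part_eq0 ?qratio0 //; lia.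
Qed.

Lemma powS_neq0 (S : nat -> F) (la : intpart) : (forall i, S i != 0) -> powS S la != 0.
Proof.
move=> h; rewrite (powSE _ (leqnn _)) prodf_seq_neq0; apply/allP => i _ /=.
by rewrite expf_neq0 // oppr_eq0.
Qed.

Lemma cfun_neq0 (S : nat -> F) (la : intpart) :
  (forall i j, (0 < i)%N -> S i ^+ 2 * q ^+ j != 1) -> cfun q S la != 0.
Proof.
move=> h; rewrite (cfunE _ (leqnn _)) prodf_seq_neq0; apply/allP => i _ /=.
by apply: qratio_neq0 => // j; apply: h.
Qed.

(** Each of the two functions contributes one factor in the summed partition, so only squares enter;
    they are the gauge powers of the transfers. *)
Lemma powS_sqr (S : nat -> F) L (la nu : intpart) : (forall i, S i != 0) ->
  (size la <= L)%N -> (size nu <= L)%N ->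
  (powS S nu / powS S la) ^+ 2
  = (S 0 ^+ 2) ^+ part nu 1 / (S 0 ^+ 2) ^+ part la 1
    * \prod_(c < L) ((S c.+1 ^+ 2) ^+ part nu c.+2 / (S c.+1 ^+ 2) ^+ part la c.+2).
Proof.
move=> hS hla hnu.
rewrite (powSE S (leqW hla)) (powSE S (leqW hnu)) -prodf_div -prodrXl.
rewrite big_ord_recl /=.
have e c : ((- S c) ^+ part nu c.+1 / (- S c) ^+ part la c.+1) ^+ 2
   = (S c ^+ 2) ^+ part nu c.+1 / (S c ^+ 2) ^+ part la c.+1.
  by rewrite exprMn exprVn -!exprM !(mulnC _ 2) !exprM sqrrN.
by rewrite e; congr (_ * _); apply: eq_bigr => c _; rewrite e /bump leq0n add1n.
Qed.

End Kernels.

Lemma mul4_neq0 (F : fieldType) (a f b g : F) :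
  a * f * (b * g) != 0 -> f != 0 /\ g != 0.
Proof.
by move=> h; split; apply: contraNneq h => ->; rewrite ?(mul0r, mulr0).
Qed.

(** * The identity for one row of each kind *)

Section RowExchange.
Variables (F : fieldType) (q : F) (Xi S Xi' S' : nat -> F) (u x : F).
Hypotheses (hq0 : q != 0) (hq : forall k : nat, (0 < k)%N -> q ^+ k != 1).
Hypotheses (hXi : forall i, Xi i != 0) (hS : forall i, S i != 0).
Hypotheses (hXi' : forall i, Xi' i != 0) (hS' : forall i, S' i != 0).
Hypothesis hx : x != 0.
Hypothesis shift : forall i, Xi' i * S' i = Xi i.+1 * S i.+1.
Hypothesis ratio : forall i, S' i / Xi' i = S i / Xi i.
Hypothesis gS : forall i j, (0 < i)%N -> S i ^+ 2 * q ^+ j != 1.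
Hypothesis gS' : forall i j, (0 < i)%N -> S' i ^+ 2 * q ^+ j != 1.
Hypothesis hu : forall i, (0 < i)%N -> u * Xi i * S i != 1.

Let P i := Xi i * S i.
Let rho i := S i / Xi i.
Let t2 c := P c.+1 / x.

Variables (L N : nat) (nu mu : intpart).
Hypotheses (hN : (part nu 1 < N)%N) (hnu : (size nu <= L)%N) (hmu : (size mu < L)%N).

Let nuf c := part nu c.+1.
Let muf c := part mu c.+1.
Let nuf_anti c : (nuf c.+1 <= nuf c)%N. Proof. exact: part_anti. Qed.
Let muf_anti c : (muf c.+1 <= muf c)%N. Proof. exact: part_anti. Qed.
Let hmu' : (size mu <= L)%N. Proof. exact: ltnW. Qed.

Let D := \prod_(c < L) (1 - S c.+1 * (u * Xi c.+1)).
Let D' := \prod_(c < L) (1 - S' c.+1 * (u * Xi' c.+1)).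
Let TL := transferL q Xi S S' u x nuf muf.
Let TR := transferR q Xi S Xi' S' u x nuf muf.
Let iL := initL q Xi S u x nuf muf.
Let iR := initR q Xi S Xi' S' u x nuf muf.

(** A summand factors over columns: [D] collects the denominators of [wwt], and the [cfun] quotient
    normalises [W]. Outside the range tested by [initL] both sides vanish by the support lemmas. *)
Lemma row_exchangeL (la : intpart) : (size la <= L)%N ->
  powS S nu / powS S la * Fkernel q u Xi S L la nu
  * (powS S' mu * cfun q S' mu / (powS S la * cfun q S la)
     * Gkernel q x (rho 0) t2 S' L la mu)
  = powS S' mu / powS S nu / D
    * (iL (part la 1) * \prod_(c < L) TL c (part la c.+1) (part la c.+2)).
Proof.
move=> hla.
have D0 : D != 0.
  rewrite prodf_seq_neq0; apply/allP => c _ /=.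
  by rewrite subr_eq0 eq_sym mulrC hu.
have n0 := powS_neq0 nu hS; have l0 := powS_neq0 la hS.
have cl0 := cfun_neq0 hq la gS.
have [sup|nsup] := boolP ((nuf 0 <= part la 1 <= (nuf 0).+1)%N
    && (muf 0 <= part la 1)%N); last first.
  rewrite /iL /initL (negbTE nsup) mul0r mulr0; apply/eqP/contraT.
  case/mul4_neq0 => h1 h2.
  have [h3 h4] := Fkernel_supp hla hnu h1.
  have [h5 _] := Gkernel_supp hla hmu' h2.
  by move: nsup; rewrite /nuf /muf h3 // h4 // h5.
rewrite /iL /initL sup /row_alpha /TL /transferL 6!big_split /= -/D.
rewrite (_ : powS S nu / powS S la * _ * _ =
  powS S' mu / powS S nu * (powS S nu / powS S la) ^+ 2 * (cfun q S' mu / cfun q S la)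
  * (Fkernel q u Xi S L la nu * Gkernel q x (rho 0) t2 S' L la mu)); last first.
  by field; rewrite n0 l0 cl0.
rewrite (powS_sqr hS hla hnu) !(cfunE q _ hla) (cfunE q _ hmu') big_split /=.
rewrite !prodfV /Fkernel /Gkernel /row_weight /pos_nat subn_gt0.
rewrite /nuf /muf /t2 /rho /P.
rewrite /mconj -[LHS]mulr1 -(divff D0); ring.
Qed.

Lemma row_exchangeR (la : intpart) : (size la <= L)%N ->
  powS S' la * cfun q S' la / (powS S nu * cfun q S nu)
     * Gkernel q x (rho 0) t2 S' L nu la
  * (powS S' la / powS S' mu * Fkernel q u Xi' S' L mu la)
  = powS S' mu / powS S nu / D'
    * (iR (part la 1) * \prod_(c < L) TR c (part la c.+1) (part la c.+2)).
Proof.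
move=> hla.
have D0 : D' != 0.
  rewrite prodf_seq_neq0; apply/allP => c _ /=.
  by rewrite subr_eq0 eq_sym mulrC -mulrA shift mulrA hu.
have n0 := powS_neq0 nu hS; have l0 := powS_neq0 mu hS'.
have cl0 := cfun_neq0 hq nu gS.
have [sup|nsup] := boolP ((part la 1 <= muf 0 <= (part la 1).+1)%N
    && (part la 1 <= nuf 0)%N); last first.
  rewrite /iR /initR (negbTE nsup) mul0r mulr0; apply/eqP/contraT.
  case/mul4_neq0 => h2 h1.
  have [h3 h4] := Fkernel_supp hmu' hla h1.
  have [h5 _] := Gkernel_supp hnu hla h2.
  by move: nsup; rewrite /nuf /muf h3 // h4 // h5.
rewrite /iR /initR sup /row_alpha /TR /transferR 6!big_split /= -/D'.
rewrite (_ : powS S' la * cfun q S' la / _ * _ * _ =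
  powS S' mu / powS S nu * (powS S' la / powS S' mu) ^+ 2 * (cfun q S' la / cfun q S nu)
  * (Fkernel q u Xi' S' L mu la * Gkernel q x (rho 0) t2 S' L nu la)); last first.
  by field; rewrite n0 l0 cl0.
rewrite (powS_sqr hS' hmu' hla) !(cfunE q _ hla) (cfunE q _ hnu) big_split /=.
rewrite !prodfV /Fkernel /Gkernel /row_weight /pos_nat subn_gt0.
rewrite /nuf /muf /t2 /rho /P.
rewrite /mconj -[LHS]mulr1 -(divff D0); ring.
Qed.

Lemma row_exchange :
  \sum_(la : {ffun 'I_L -> 'I_N.+1})
    powS S nu / powS S (boxpart la) * Fkernel q u Xi S L (boxpart la) nu
    * (powS S' mu * cfun q S' mu / (powS S (boxpart la) * cfun q S (boxpart la))
       * Gkernel q x (rho 0) t2 S' L (boxpart la) mu)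
  = (1 - u * x) / (1 - u * P 1) *
  \sum_(la : {ffun 'I_L -> 'I_N.+1})
    powS S' (boxpart la) * cfun q S' (boxpart la) / (powS S nu * cfun q S nu)
     * Gkernel q x (rho 0) t2 S' L nu (boxpart la)
    * (powS S' (boxpart la) / powS S' mu * Fkernel q u Xi' S' L mu (boxpart la)).
Proof.
have E T i := @path_vec_sum F N L T i 0 0.
under eq_bigr => la _ do rewrite row_exchangeL ?size_boxpart //.
under [in RHS]eq_bigr => la _ do rewrite row_exchangeR ?size_boxpart //.
rewrite -!mulr_sumr.
have -> : \sum_(la : {ffun 'I_L -> 'I_N.+1}) (iL (part (boxpart la) 1) *
    \prod_(c < L) TL c (part (boxpart la) c.+1) (part (boxpart la) c.+2))
    = path_vec N TL iL L 0.
  rewrite -(E TL iL); apply: eq_bigr => la _; rewrite part_boxpart; congr (_ * _).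
  by apply: eq_bigr => c _; rewrite !part_boxpart.
have -> : \sum_(la : {ffun 'I_L -> 'I_N.+1}) (iR (part (boxpart la) 1) *
    \prod_(c < L) TR c (part (boxpart la) c.+1) (part (boxpart la) c.+2))
    = path_vec N TR iR L 0.
  rewrite -(E TR iR); apply: eq_bigr => la _; rewrite part_boxpart; congr (_ * _).
  by apply: eq_bigr => c _; rewrite !part_boxpart.
have nuL : nuf L = 0%N by rewrite /nuf part_eq0.
have muL : muf L = 0%N by rewrite /muf part_eq0 // ltnW.
(* The strict bound [size mu < L] enters here: the final value is at most the [L]-th part of [mu],
   which is 0. *)
have L1 : path_vec N TL iL L 1 = 0.
  apply/eqP/contraT => h; have [_ _] := vecL_supp hq0 hx nuf_anti muf_anti h.
  have hL : (0 < L)%N by apply: leq_ltn_trans hmu.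
  by move=> /(_ hL); rewrite /muf prednK // part_eq0.
have := transfer_relation hq0 hq hXi hS hXi' hS' hx shift ratio gS gS' hu nuf_anti
  muf_anti hN (c := L).
rewrite muL nuL => /(_ isT) [+ _].
rewrite -/TL -/TR -/iL -/iR L1 subn0 mulr0 addr0 expr1 divff // mulr1 => h.
have u1 : 1 - u * P 1 != 0 by rewrite subr_eq0 eq_sym /P mulrA hu.
have D0 : D != 0.
  rewrite prodf_seq_neq0; apply/allP => c _ /=.
  by rewrite subr_eq0 eq_sym mulrC hu.
have D'0 : D' != 0.
  rewrite prodf_seq_neq0; apply/allP => c _ /=.
  by rewrite subr_eq0 eq_sym mulrC -mulrA shift mulrA hu.
have n0 := powS_neq0 nu hS.
(* The shift makes [D'] the product [D] moved by one index; the extra factor [1 - u * P L.+1] is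
   supplied by [transfer_relation] at [c = L]. *)
have DD : D * (1 - u * P L.+1) = (1 - u * P 1) * D'.
  transitivity (\prod_(c < L.+1) (1 - u * P c.+1)).
    rewrite big_ord_recr /=; congr (_ * _); apply: eq_bigr => c _.
    by rewrite /P; ring.
  rewrite big_ord_recl /=; congr (_ * _); apply: eq_bigr => c _.
  by rewrite /bump leq0n add1n /P -shift; ring.
set v := path_vec N TL iL L 0 in h *; set w := path_vec N TR iR L 0 in h *.
transitivity (powS S' mu / powS S nu * (D * (1 - u * P L.+1) * v) / D / D' / (1 - u * P 1)).
  by rewrite DD; field; rewrite n0 D0 D'0 u1.
rewrite -mulrA -(mulrA D) -h; field.
by rewrite n0 D0 D'0 u1.
Qed.
End RowExchange.

(** * Chains of kernels *)

Section Chains.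
Variables (F : fieldType) (X : finType).
Implicit Types (x y z : X).

Fixpoint chain_sum n : ('I_n -> X -> X -> F) -> X -> X -> F :=
  if n is n'.+1 then fun K x y =>
    \sum_z K ord0 x z * chain_sum (fun r => K (lift ord0 r)) z y
  else fun _ x y => (x == y)%:R.

Lemma sum_neq0 (I : finType) (f : I -> F) : \sum_i f i != 0 -> exists i, f i != 0.
Proof.
move=> h; apply/existsP; rewrite -negb_forall; apply: contraNN h => /forallP h.
by rewrite big1 // => i _; apply/eqP.
Qed.

Lemma chain_sum_rel n (K : 'I_n -> X -> X -> F) (Rl : nat -> X -> X -> Prop) x y :
  (forall x, Rl 0%N x x) ->
  (forall r x z y k, K r x z != 0 -> Rl k z y -> Rl k.+1 x y) ->
  chain_sum K x y != 0 -> Rl n x y.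
Proof.
move=> R0; elim: n K x => [|n IHn] K x RS /=.
  by have [->|_] := eqVneq x y; rewrite ?eqxx.
case/sum_neq0 => z; rewrite mulf_eq0 negb_or => /andP[h1 h2].
apply: (RS ord0 _ z) => //; apply: (IHn _ _ _ h2) => r x' z' y' k.
exact: RS.
Qed.

Lemma eq_chain_sum n (K K' : 'I_n -> X -> X -> F) x y :
  (forall r x y, K r x y = K' r x y) -> chain_sum K x y = chain_sum K' x y.
Proof.
elim: n K K' x => [//|n IHn] K K' x h /=.
by apply: eq_bigr => z _; rewrite h (IHn _ (fun r => K' (lift ord0 r))).
Qed.

(** The factors [phi] telescope along a chain; this spreads the global prefactors of both functions
    over their rows. *)
Lemma chain_sum_gauge n (phi : nat -> X -> F) (K : 'I_n -> X -> X -> F) x y :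
  (forall r x, (r <= n)%N -> phi r x != 0) ->
  chain_sum (fun (r : 'I_n) x y => phi r.+1 y / phi r x * K r x y) x y
  = phi n y / phi 0%N x * chain_sum K x y.
Proof.
elim: n phi K x => [|n IHn] phi K x h /=.
  by case: eqP => [->|_]; rewrite ?mulr0 // mulr1 divff // h.
rewrite mulr_sumr; apply: eq_bigr => z _.
have e : chain_sum (fun (r : 'I_n) x y =>
     phi (lift ord0 r).+1 y / phi (lift ord0 r) x * K (lift ord0 r) x y) z y
   = phi n.+1 y / phi 1%N z * chain_sum (fun r => K (lift ord0 r)) z y.
  rewrite -(IHn (fun r => phi r.+1)); last by move=> r x' hr; apply: h.
  by apply: eq_chain_sum => r x2 y2; rewrite lift0.
rewrite e /=.
have h1 := h 1%N z isT; have h0 := h 0%N x isT.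
by field; rewrite h0 h1.
Qed.

Lemma big_chain n (K : 'I_n -> X -> X -> F) x y :
  \sum_(k : {ffun 'I_n.+1 -> X} | (k ord0 == x) && (k ord_max == y))
    \prod_(r < n) K r (k (widen_ord (leqnSn n) r)) (k (lift ord0 r))
  = chain_sum K x y.
Proof.
elim: n K x => [|n IHn] K x.
  rewrite (eq_bigl (fun k => (k == [ffun => x]) && (x == y))); last first.
    move=> k /=; rewrite (_ : ord_max = ord0); last exact/val_inj.
    have -> : (k == [ffun => x]) = (k ord0 == x).
      apply/eqP/eqP => [->|<-]; first by rewrite ffunE.
      by apply/ffunP => i; rewrite ffunE ord1.
    by case: eqP => [->|].
  rewrite /=; case: eqP => _.
    rewrite (eq_bigl (fun k => k == [ffun => x])); last by move=> k; rewrite andbT.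
    by rewrite big_pred1_eq big_ord0.
  by rewrite big_pred0 // => k; rewrite andbF.
rewrite big_mkcond big_ffcons (bigD1 x) //= [X in _ + X]big1 ?addr0; last first.
  move=> x' hx; rewrite big1 // => k _.
  by rewrite ffcons0 (negbTE hx).
transitivity (\sum_(k : {ffun 'I_n.+1 -> X} | k ord_max == y)
   K ord0 x (k ord0) * \prod_(r < n)
     K (lift ord0 r) (k (widen_ord (leqnSn n) r)) (k (lift ord0 r))).
  rewrite [RHS]big_mkcond; apply: eq_bigr => k _.
  rewrite ffcons0 eqxx (_ : ord_max = lift ord0 ord_max); last exact/val_inj.
  rewrite ffconsS /=; case: eqP => // _.
  rewrite big_ord_recl ffconsS (_ : widen_ord _ ord0 = ord0); last exact/val_inj.
  rewrite ffcons0; congr (_ * _); apply: eq_bigr => r _.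
  rewrite ffconsS (_ : widen_ord _ (lift ord0 r) = lift ord0 (widen_ord (leqnSn n) r)).
    by rewrite ffconsS.
  exact/val_inj.
rewrite (partition_big (fun k : {ffun 'I_n.+1 -> X} => k ord0) xpredT) //=.
apply: eq_bigr => z _; rewrite -IHn mulr_sumr.
rewrite (eq_bigl (fun k : {ffun 'I_n.+1 -> X} => (k ord0 == z) && (k ord_max == y))).
  by apply: eq_bigr => k /andP[/eqP -> _].
by move=> k; rewrite andbC.
Qed.

Section Exchange.
Variables (wd ln : X -> nat) (N L : nat).

(** Moves one [g] past [m] kernels [f]. The exchange is only available inside the box; each [f]
    raises [wd] by at most one, hence the margin [m], while [ln] does not grow along [f']. *)
Lemma chain_exchange_right m (f f' : 'I_m -> X -> X -> F) (g : X -> X -> F)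
    (C : 'I_m -> F) y z :
  (forall j y z, (wd y < N)%N -> (ln z < L)%N ->
     \sum_x f j x y * g x z = C j * \sum_x g y x * f' j z x) ->
  (forall j x y, f j x y != 0 -> (wd x <= (wd y).+1)%N) ->
  (forall j z x, f' j z x != 0 -> (ln x <= ln z)%N) ->
  (wd y + m <= N)%N -> (ln z < L)%N ->
  \sum_x chain_sum f x y * g x z
  = (\prod_j C j) * \sum_x g y x * chain_sum f' z x.
Proof.
elim: m f f' C z => [|m IHm] f f' C z hex hf hf' hy hz /=.
  rewrite big_ord0 mul1r (bigD1 y) //= eqxx mul1r big1 ?addr0; last first.
    by move=> x /negbTE ->; rewrite mul0r.
  rewrite (bigD1 z) //= eqxx mulr1 big1 ?addr0 // => x.
  by rewrite eq_sym => /negbTE ->; rewrite mulr0.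
set fr := fun r => f (lift ord0 r); set fr' := fun r => f' (lift ord0 r).
transitivity (\sum_k chain_sum fr k y * \sum_x f ord0 x k * g x z).
  under [RHS]eq_bigr => k _ do rewrite mulr_sumr.
  rewrite exchange_big; apply: eq_bigr => x _; rewrite mulr_suml.
  by apply: eq_bigr => k _; rewrite mulrCA mulrA.
transitivity (C ord0 * \sum_s f' ord0 z s * \sum_k chain_sum fr k y * g k s).
  transitivity (\sum_k chain_sum fr k y * (C ord0 * \sum_s g k s * f' ord0 z s)).
    apply: eq_bigr => k _; have [->|hk] := eqVneq (chain_sum fr k y) 0.
      by rewrite !mul0r.
    rewrite hex //.
    have := @chain_sum_rel _ fr (fun i x y => (wd x <= wd y + i)%N) _ _ _ _ hk.
    have hs x0 : (wd x0 <= wd x0 + 0)%N by rewrite addn0.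
    move=> /(_ hs) H; apply: leq_trans hy; rewrite addnS ltnS; apply: H.
    by move=> r x0 z0 y0 i /hf h1 h2; rewrite addnS (leq_trans h1).
  under eq_bigr => k _ do rewrite mulrCA.
  rewrite -mulr_sumr; congr (_ * _).
  under eq_bigr => k _ do rewrite mulr_sumr.
  rewrite exchange_big; apply: eq_bigr => s _; rewrite mulr_sumr.
  by apply: eq_bigr => k _; ring.
rewrite big_ord_recl -mulrA; congr (_ * _).
transitivity (\sum_s f' ord0 z s *
   ((\prod_(i < m) C (lift ord0 i)) * \sum_x g y x * chain_sum fr' s x)).
  apply: eq_bigr => s _; have [->|hs] := eqVneq (f' ord0 z s) 0.
    by rewrite !mul0r.
  congr (_ * _); apply: IHm.
  - by move=> j y0 z0; apply: hex.
  - by move=> j x0 y0; apply: hf.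
  - by move=> j x0 y0; apply: hf'.
  - by lia.
  - by apply: leq_ltn_trans hz; apply: hf' hs.
transitivity ((\prod_(i < m) C (lift ord0 i)) *
   \sum_s f' ord0 z s * \sum_x g y x * chain_sum fr' s x).
  by rewrite mulr_sumr; apply: eq_bigr => s _; ring.
congr (_ * _).
under eq_bigr => s _ do rewrite mulr_sumr.
rewrite exchange_big; apply: eq_bigr => x _; rewrite mulr_sumr.
by apply: eq_bigr => s _; rewrite mulrCA.
Qed.

(** Moves [f] past [n] kernels [g], its level rising by one each time; here the margin is in
    [ln]. *)
Lemma chain_exchange n (f : nat -> X -> X -> F) (g : 'I_n -> X -> X -> F)
    (C : 'I_n -> F) (M : nat) y z :
  (forall (i : 'I_n) y z, (wd y <= M)%N -> (ln z < L)%N ->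
     \sum_x f i x y * g i x z = C i * \sum_x g i y x * f i.+1 z x) ->
  (forall i x z, g i x z != 0 -> (ln x <= (ln z).+1)%N) ->
  (forall i y x, g i y x != 0 -> (wd x <= wd y)%N) ->
  (wd y <= M)%N -> (ln z + n <= L)%N ->
  \sum_x f 0%N x y * chain_sum g x z
  = (\prod_i C i) * \sum_x chain_sum g y x * f n z x.
Proof.
elim: n f g C y => [|n IHn] f g C y hex hg hg' hy hz /=.
  rewrite big_ord0 mul1r (bigD1 z) //= eqxx mulr1 big1 ?addr0; last first.
    by move=> x /negbTE ->; rewrite mulr0.
  rewrite (bigD1 y) //= eqxx mul1r big1 ?addr0 // => x.
  by rewrite eq_sym => /negbTE ->; rewrite mul0r.
set gr := fun r => g (lift ord0 r).
transitivity (\sum_k chain_sum gr k z * \sum_x f 0%N x y * g ord0 x k).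
  under [RHS]eq_bigr => k _ do rewrite mulr_sumr.
  rewrite exchange_big; apply: eq_bigr => x _; rewrite mulr_sumr.
  by apply: eq_bigr => k _; ring.
transitivity (C ord0 * \sum_s g ord0 y s * \sum_k f 1%N k s * chain_sum gr k z).
  transitivity (\sum_k chain_sum gr k z * (C ord0 * \sum_s g ord0 y s * f 1%N k s)).
    apply: eq_bigr => k _; have [->|hk] := eqVneq (chain_sum gr k z) 0.
      by rewrite !mul0r.
    rewrite (hex ord0) //.
    have := @chain_sum_rel _ gr (fun i x y => (ln x <= ln y + i)%N) _ _ _ _ hk.
    have hs x0 : (ln x0 <= ln x0 + 0)%N by rewrite addn0.
    move=> /(_ hs) H; apply: leq_trans hz; rewrite addnS ltnS; apply: H.
    by move=> r x0 z0 y0 i /hg h1 h2; rewrite addnS (leq_trans h1).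
  under eq_bigr => k _ do rewrite mulrCA.
  rewrite -mulr_sumr; congr (_ * _).
  under eq_bigr => k _ do rewrite mulr_sumr.
  rewrite exchange_big; apply: eq_bigr => s _; rewrite mulr_sumr.
  by apply: eq_bigr => k _; ring.
rewrite big_ord_recl -mulrA; congr (_ * _).
transitivity (\sum_s g ord0 y s *
   ((\prod_(i < n) C (lift ord0 i)) * \sum_x chain_sum gr s x * f n.+1 z x)).
  apply: eq_bigr => s _; have [->|hs] := eqVneq (g ord0 y s) 0.
    by rewrite !mul0r.
  congr (_ * _); apply: (IHn (fun r => f r.+1)).
  - by move=> i y0 z0; have := hex (lift ord0 i) y0 z0; rewrite lift0.
  - by move=> j x0 y0; apply: hg.
  - by move=> j x0 y0; apply: hg'.
  - by apply: leq_trans hy; apply: hg' hs.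
  - by lia.
transitivity ((\prod_(i < n) C (lift ord0 i)) *
   \sum_s g ord0 y s * \sum_x chain_sum gr s x * f n.+1 z x).
  by rewrite mulr_sumr; apply: eq_bigr => s _; ring.
congr (_ * _).
transitivity (\sum_s \sum_x g ord0 y s * (chain_sum gr s x * f n.+1 z x)).
  by apply: eq_bigr => s _; rewrite mulr_sumr.
rewrite exchange_big; apply: eq_bigr => x _; rewrite mulr_suml.
by apply: eq_bigr => s _; rewrite mulrA.
Qed.

End Exchange.
End Chains.

(** * Lattice sums as chains *)

Local Open Scope classical_set_scope.
Local Open Scope ring_scope.

Lemma fsum_finType (R : nmodType) (J : choiceType) (K : finType) (A : set J)
    (Q : pred K) (phi : K -> J) (G : J -> R) :
  {in Q &, injective phi} -> (forall k, Q k -> A (phi k)) ->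
  (forall j, A j -> G j != 0 -> exists2 k, Q k & phi k = j) ->
  \sum_(j \in A) G j = \sum_(k | Q k) G (phi k).
Proof.
move=> hinj hA hG; rewrite (fsbigE [seq phi k | k <- enum Q]).
- rewrite big_map big_enum_cond /=; apply: eq_bigl => k.
  rewrite unfold_in; case: (boolP (Q k)) => //= /hA h.
  exact: mem_set.
- rewrite map_inj_in_uniq ?enum_uniq // => k l.
  by rewrite !mem_enum; apply: hinj.
- by move=> j /= /mapP [k]; rewrite mem_enum => /hA h ->.
- move=> j /hG h h'; apply/eqP; apply: contraNT h' => /h [k hk <-].
  by apply: map_f; rewrite mem_enum.
Qed.

Section LatticeChain.
Variables (F : fieldType) (H : choiceType) (h0 : H).
Variables (hof : nat -> H) (hval : H -> nat).
Hypotheses (hvalK : cancel hval hof) (hval0 : hval h0 = 0%N).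
Variables (n L0 L N : nat) (wt : 'I_n -> nat -> nat -> H -> nat -> H -> F).
Hypothesis conserve : forall r c i j k l,
  wt r c i j k l != 0 -> (i + hval j = k + hval l)%N.
Hypothesis empty : forall r c, (0 < c)%N -> wt r c 0 h0 0 h0 = 1.

Let X := {ffun 'I_L -> 'I_N.+1}.
Variables (a : 'I_n -> H) (x y : X).
Hypotheses (hL : (L0 <= L)%N) (hN : (part (boxpart x) 1 <= N)%N).
Hypotheses (hx : (size (boxpart x) <= L0)%N) (hy : (size (boxpart y) <= L0)%N).

Let chain := {ffun 'I_n.+1 -> X}.
Let lam (k : chain) r := boxpart (k r).
Let up (r : 'I_n) : 'I_n.+1 := widen_ord (leqnSn n) r.
Let dn (r : 'I_n) : 'I_n.+1 := lift ord0 r.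

Let hof0 : hof 0 = h0. Proof. by rewrite -hval0 hvalK. Qed.

Definition chain_diff (k : chain) (r : 'I_n) : nat :=
  (part (lam k (up r)) 1 - part (lam k (dn r)) 1)%N.

Let ends (k : chain) := (k ord0 == x) && (k ord_max == y).
Let starts (k : chain) := [forall r, a r == hof (chain_diff k r)].
Let short (k : chain) := [forall r, (size (lam k r) <= L0)%N].

Let phi (k : chain) : 'M[nat]_(n.+1, L0) * 'M[H]_(n, L0.+1) :=
  (\matrix_(r, c) mconj (lam k r) c.+1,
   \matrix_(r, c) hof (part (lam k (up r)) c.+1 - part (lam k (dn r)) c.+1)%N).

Let paths := [set vh : 'M[nat]_(n.+1, L0) * 'M[H]_(n, L0.+1) |
         [/\ forall c : 'I_L0, vh.1 ord0 c = mconj (boxpart x) c.+1,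
             forall c : 'I_L0, vh.1 ord_max c = mconj (boxpart y) c.+1,
             forall r : 'I_n, vh.2 r ord0 = a r &
             forall r : 'I_n, vh.2 r ord_max = h0]].

Let chain_weight (k : chain) :=
  \prod_(r < n) row_weight hof (wt r) L (lam k (up r)) (lam k (dn r)).

Lemma chain_weight_short k : ends k -> chain_weight k != 0 -> short k.
Proof.
move=> /andP[/eqP hk _]; rewrite prodf_seq_neq0 => /allP h.
suff H1 i (hi : (i < n.+1)%N) : (size (lam k (Ordinal hi)) <= L0)%N.
  by apply/forallP => -[r hr].
elim: i hi => [|i IHi] hi.
  by rewrite (_ : Ordinal hi = ord0) /lam ?hk //; apply/val_inj.
have hi' : (i < n)%N by [].
have /row_weight_supp := h (Ordinal hi') (mem_index_enum _).
move=> /(_ hval); rewrite hof0 => /(_ hval0 (@conserve _)).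
rewrite !size_boxpart => /(_ isT isT) [/subpart_size h1 _].
have e1 : dn (Ordinal hi') = Ordinal hi by apply/val_inj; rewrite /= /bump leq0n.
have e2 : up (Ordinal hi') = Ordinal (ltnW hi) by apply/val_inj.
by move: h1; rewrite e1 e2 => /leq_trans; apply.
Qed.

Lemma paths_chain vh : paths vh ->
  (\prod_(r < n) \prod_(c < L0)
      wt r c.+1 (vh.1 (lift ord0 r) c) (vh.2 r (widen_ord (leqnSn L0) c))
                (vh.1 (widen_ord (leqnSn n) r) c) (vh.2 r (lift ord0 c))) != 0 ->
  exists2 k, ends k && starts k && short k & phi k = vh.
Proof.
case: vh => v h [/= htop hbot hleft hright]; rewrite prodf_seq_neq0 => /allP hw.
have cons (r : 'I_n) (c : 'I_L0) :
    (v (dn r) c + hval (h r (widen_ord (leqnSn L0) c))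
     = v (up r) c + hval (h r (lift ord0 c)))%N.
  have := hw r (mem_index_enum _); rewrite prodf_seq_neq0 => /allP hw'.
  exact: conserve (hw' c (mem_index_enum _)).
pose V r i : nat := oapp (v r) 0%N (insub i : option 'I_L0).
have VE r (c : 'I_L0) : V r c = v r c by rewrite /V valK.
have V0 r i : (L0 <= i)%N -> V r i = 0%N.
  by move=> hi; rewrite /V insubF // ltnNge hi.
(* Tail sums of the vertical labels recover the parts of the partition at height [r]. *)
pose t r c := (\sum_(c <= i < L) V r i)%N.
have tS r c : (c < L)%N -> t r c = (V r c + t r c.+1)%N.
  by move=> hc; rewrite /t big_ltn.
have t0 r c : (L0 <= c)%N -> t r c = 0%N.
  move=> hc; rewrite /t big_nat_cond big1 // => i /andP[/andP[hi _] _].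
  by apply: V0; apply: leq_trans hi.
(* Conservation summed from the empty right edge: a horizontal label is a difference of tail
   sums. *)
have th (r : 'I_n) (c : 'I_L0.+1) : (t (dn r) c + hval (h r c) = t (up r) c)%N.
  suff H1 d (hd : (d <= L0)%N) (hd' : (L0 - d < L0.+1)%N) :
      (t (dn r) (L0 - d) + hval (h r (Ordinal hd')) = t (up r) (L0 - d))%N.
    have hc : (L0 - (L0 - c) < L0.+1)%N by rewrite ltnS leq_subr.
    have := H1 (L0 - c)%N (leq_subr _ _) hc.
    rewrite (_ : Ordinal hc = c); last by apply/val_inj; rewrite /= subKn // -ltnS.
    by rewrite subKn // -ltnS.
  elim: d hd hd' => [|d IHd] hd hd'.
    rewrite !t0 ?subn0 // (_ : Ordinal hd' = ord_max) ?hright ?hval0 //.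
    by apply/val_inj; rewrite /= subn0.
  have hc : (L0 - d.+1 < L0)%N by lia.
  have := cons r (Ordinal hc).
  rewrite (_ : widen_ord _ _ = Ordinal hd'); last exact/val_inj.
  have e : ((L0 - d.+1).+1 = L0 - d)%N by lia.
  have hd2 : (L0 - d < L0.+1)%N by lia.
  rewrite (_ : lift ord0 (Ordinal hc) = Ordinal hd2); last first.
    by apply/val_inj; rewrite /= /bump leq0n add1n e.
  have := IHd (ltnW hd) hd2; rewrite !(tS _ (L0 - d.+1)%N) ?e; [|lia|lia].
  rewrite -(VE (dn r) (Ordinal hc)) -(VE (up r) (Ordinal hc)) /=; lia.
have xV (c : 'I_L) : x c = V ord0 c :> nat.
  rewrite -(mconj_boxpart x c); have [hc|hc] := ltnP c L0.
    by rewrite (VE ord0 (Ordinal hc)) htop.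
  by rewrite V0 // mconjE !part_eq0 //; lia.
have yV (c : 'I_L) : y c = V ord_max c :> nat.
  rewrite -(mconj_boxpart y c); have [hc|hc] := ltnP c L0.
    by rewrite (VE ord_max (Ordinal hc)) hbot.
  by rewrite V0 // mconjE !part_eq0 //; lia.
have tx c : t ord0 c = tailsum x c.
  rewrite /t /tailsum big_geq_mkord; apply: eq_bigr => i _; exact/esym/xV.
(* Tail sums can only decrease from one row to the next, so the bound for the top partition [x]
   holds throughout. *)
have tN r c : (t r c <= N)%N.
  have tc : (t r c <= t r 0)%N.
    elim: c => // c; apply: leq_trans; have [hc|hc] := ltnP c L.
      by rewrite (tS _ _ hc) leq_addl.
    by rewrite /t !big_geq //; lia.
  apply: leq_trans tc _.
  suff H1 i (hi : (i < n.+1)%N) : (t (Ordinal hi) 0 <= N)%N by case: r.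
  elim: i hi => [|i IHi] hi.
    rewrite (_ : Ordinal hi = ord0); last exact/val_inj.
    by rewrite tx -part_boxpart.
  have hi' : (i < n)%N by [].
  have := th (Ordinal hi') ord0.
  have -> : dn (Ordinal hi') = Ordinal hi by apply/val_inj; rewrite /= /bump leq0n.
  have -> : up (Ordinal hi') = Ordinal (ltnW hi) by apply/val_inj.
  by have := IHi (ltnW hi); rewrite /=; lia.
have VN r (c : 'I_L) : (V r c < N.+1)%N.
  by have := tN r c; rewrite (tS _ _ (ltn_ord c)); lia.
pose k : chain := [ffun r => [ffun c : 'I_L => inord (V r c)]].
have kE r (c : 'I_L) : k r c = V r c :> nat by rewrite !ffunE inordK.
have kt r c : tailsum (k r) c = t r c.
  by rewrite /t /tailsum big_geq_mkord; apply: eq_bigr => i _; rewrite kE.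
have hk (r : 'I_n) (c : 'I_L0.+1) :
    hof (part (lam k (up r)) c.+1 - part (lam k (dn r)) c.+1)%N = h r c.
  by rewrite !part_boxpart !kt -(th r c) addKn hvalK.
exists k; last first.
  congr pair; apply/matrixP => r c; rewrite mxE ?hk //.
  have hc : (c < L)%N by apply: leq_trans hL.
  by rewrite -(VE r c) (mconj_boxpart (k r) (Ordinal hc)) kE.
apply/andP; split; [apply/andP; split; [apply/andP; split|]|].
- by apply/eqP/ffunP => c; apply/val_inj; rewrite /= kE xV.
- by apply/eqP/ffunP => c; apply/val_inj; rewrite /= kE yV.
- by apply/forallP => r; rewrite /chain_diff (hk r ord0) hleft.
- apply/forallP => r; rewrite leqNgt; apply/negP => h1.
  have := intpart_gt0 (lam k r) (ltn0Sn L0).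
  by rewrite h1 part_boxpart kt t0.
Qed.

(** Configurations of nonzero weight correspond to chains of partitions with the prescribed left
    labels. Widening from [L0] to [L] adds only empty vertices of weight 1, so all rows can share
    one box. *)
Lemma latticeZ_chain :
  latticeZ h0 L0 wt a (mconj (boxpart x)) (mconj (boxpart y))
  = \sum_(k : chain | ends k && starts k) chain_weight k.
Proof.
rewrite /latticeZ (@fsum_finType _ _ _ paths
   (fun k => ends k && starts k && short k) phi); last 1 first.
- exact: paths_chain.
- rewrite [RHS]big_mkcond [LHS]big_mkcond /=; apply: eq_bigr => k _.
  case: (boolP (ends k && starts k)) => //= /andP[hk _].
  have [hs|hs] := boolP (short k); last first.
    apply/esym/eqP; apply: contraNT hs; exact: chain_weight_short.
  apply: eq_bigr => r _.
  rewrite (@row_weight_widen _ _ hof (wt r) L0 L) ?(forallP hs) //; last first.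
    by move=> c; rewrite hof0 empty.
  by apply: eq_bigr => c _; rewrite !mxE lift0.
- move=> k l /andP[_ /forallP hk] /andP[_ /forallP hl] e.
  apply/ffunP => r; apply/ffunP => c; apply/val_inj => /=.
  rewrite -(mconj_boxpart (k r) c) -(mconj_boxpart (l r) c).
  have [hc|hc] := ltnP c L0.
    case: e => /matrixP /(_ r (Ordinal hc)) + _; by rewrite !mxE.
  have hz (k' : chain) (j : nat) : (size (lam k' r) <= L0)%N -> (L0 <= j)%N ->
      part (boxpart (k' r)) j.+1 = 0%N.
    by move=> h1 h2; apply: part_eq0; rewrite ltnS; apply: leq_trans h2.
  by rewrite !mconjE !hz // leqW.
- move=> k /andP[/andP[/andP[/eqP h1 /eqP h2] /forallP h3] /forallP h4].
  split=> [c|c|r|r] /=; rewrite !mxE /lam ?h1 ?h2 //.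
    by rewrite (eqP (h3 r)).
  rewrite !part_eq0 ?hof0 //=.
  - by have := h4 (dn r); rewrite /lam.
  - by have := h4 (up r); rewrite /lam.
Qed.

End LatticeChain.

(** * Both functions as chains of one-row kernels *)

Section Representation.
Variables (F : fieldType) (q : F).
Hypothesis hq : forall k : nat, (0 < k)%N -> q ^+ k != 1.

Lemma mconj_le1 (la : intpart) c : (0 < c)%N -> (mconj la c <= part la 1)%N.
Proof. by move=> hc; have := part_le1 la hc; rewrite mconjE; lia. Qed.

Lemma chain_sum_subpart n L N
    (K : 'I_n -> {ffun 'I_L -> 'I_N.+1} -> {ffun 'I_L -> 'I_N.+1} -> F) x y :
  (forall r x y, K r x y != 0 -> subpart (boxpart y) (boxpart x)) ->
  chain_sum K x y != 0 -> subpart (boxpart y) (boxpart x).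
Proof.
move=> hK; apply: (@chain_sum_rel _ _ n K (fun _ x y => subpart (boxpart y) (boxpart x))).
  by move=> x0 i _.
by move=> r x0 z y0 _ /hK h1 h2 i hi; apply: leq_trans (h2 i hi) (h1 i hi).
Qed.

Lemma boxpart_onto L N (la : intpart) : (size la <= L)%N -> (part la 1 <= N)%N ->
  exists x : {ffun 'I_L -> 'I_N.+1}, boxpart x = la.
Proof.
move=> h1 h2; exists (boxidx L N la); apply: boxidxK => // c hc.
exact: leq_trans (mconj_le1 la hc) h2.
Qed.

Section Vertical.
Variables (m : nat) (u : 'I_m -> F) (Xi S : nat -> F).
Hypothesis hS : forall i, S i != 0.
Hypothesis gS : forall i j, (0 < i)%N -> S i ^+ 2 * q ^+ j != 1.
Hypothesis hu : forall (r : 'I_m) i, (0 < i)%N -> u r * Xi i * S i != 1.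

Definition Frow L N (j : 'I_m) (x y : {ffun 'I_L -> 'I_N.+1}) : F :=
  powS S (boxpart y) / powS S (boxpart x)
  * Fkernel q (u j) Xi S L (boxpart x) (boxpart y).

Lemma Frow_supp L N j (x y : {ffun 'I_L -> 'I_N.+1}) : Frow j x y != 0 ->
  subpart (boxpart y) (boxpart x)
  /\ (part (boxpart x) 1 <= (part (boxpart y) 1).+1)%N.
Proof.
rewrite mulf_eq0 negb_or => /andP[_ /Fkernel_supp].
by rewrite !size_boxpart => /(_ isT isT) [h1 h2]; split=> //; apply: h2.
Qed.

(** The [cfun] quotients of [Ft] and [Ftstar] cancel, leaving [powS] as gauge. Summing over all left
    labels removes the constraint on chains. *)
Lemma Ftstar_chain L N (x y : {ffun 'I_L -> 'I_N.+1}) :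
  (ncols (boxpart x) (boxpart y) <= L)%N -> (part (boxpart x) 1 <= N)%N ->
  Ftstar q u Xi S (boxpart x) (boxpart y) = chain_sum (@Frow L N) x y.
Proof.
move=> hL hN; rewrite /Ftstar /Ft.
have c1 := cfun_neq0 hq (boxpart x) gS; have c2 := cfun_neq0 hq (boxpart y) gS.
rewrite (@chain_sum_gauge F _ m (fun _ z => powS S (boxpart z))); last first.
  by move=> r z _; apply: powS_neq0.
rewrite -big_chain.
rewrite (_ : cfun q S (boxpart x) / _ * _ = powS S (boxpart y) / powS S (boxpart x) *
  \sum_(a : {ffun 'I_m -> bool}) (\prod_(i < m) (- u i * Xi 0 * S 0) ^+ a i)
      * Zw q u Xi S (boxpart x) (boxpart y) a); last first.
  by field; rewrite c1 c2 powS_neq0.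
congr (_ * _).
rewrite (partition_big (fun k : {ffun 'I_m.+1 -> {ffun 'I_L -> 'I_N.+1}} =>
   [ffun r => pos_nat (chain_diff k r)]) xpredT) //=.
apply: eq_bigr => a _.
have hx : (size (boxpart x) <= ncols (boxpart x) (boxpart y))%N.
  by rewrite /ncols ltnW // ltnS leq_maxl.
have hy : (size (boxpart y) <= ncols (boxpart x) (boxpart y))%N.
  by rewrite /ncols ltnW // ltnS leq_maxr.
have posK : cancel nat_of_bool pos_nat by case.
have hc (r : 'I_m) c i (j : bool) k (l : bool) :
    wwt q (u r * Xi c) (S c) i j k l != 0 -> (i + j = k + l)%N.
  exact: wwt_conserve.
have h0 (r : 'I_m) c : (0 < c)%N -> wwt q (u r * Xi c) (S c) 0 false 0 false = 1.
  by move=> hc0; apply: wwt0; rewrite mulrC hu.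
rewrite /Zw (latticeZ_chain (h0 := false) posK erefl hc h0 _ hL hN hx hy) mulr_sumr.
apply: eq_big => [k|k /andP[_ /forallP hk]].
  congr (_ && _); apply/forallP/eqP => [h|<- r]; last by rewrite ffunE.
  by apply/ffunP => r; rewrite ffunE (eqP (h r)).
rewrite -big_split /=; apply: eq_bigr => r _.
by rewrite (eqP (hk r)).
Qed.

Lemma Frow_chain_supp L N (x y : {ffun 'I_L -> 'I_N.+1}) :
  chain_sum (@Frow L N) x y != 0 -> subpart (boxpart y) (boxpart x)
  /\ (part (boxpart x) 1 <= part (boxpart y) 1 + m)%N.
Proof.
move=> h; split.
  by apply: chain_sum_subpart h => r x0 y0 /Frow_supp [].
apply: (@chain_sum_rel _ _ m _
  (fun i x y => (part (boxpart x) 1 <= part (boxpart y) 1 + i)%N)) h.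
  by move=> x0; rewrite addn0.
by move=> r x0 z y0 k /Frow_supp [_ h1] h2; rewrite addnS (leq_trans h1).
Qed.

Lemma Ftstar_supp (la nu : intpart) : Ftstar q u Xi S la nu != 0 ->
  subpart nu la /\ (part la 1 <= part nu 1 + m)%N.
Proof.
have hla : (size la <= ncols la nu)%N by rewrite /ncols ltnW // ltnS leq_maxl.
have hnu : (size nu <= ncols la nu)%N by rewrite /ncols ltnW // ltnS leq_maxr.
have [x ex] := boxpart_onto hla (leq_addr (part nu 1) (part la 1)).
have [y ey] := boxpart_onto hnu (leq_addl (part la 1) (part nu 1)).
have := @Ftstar_chain _ _ x y; rewrite ex ey => -> //; last exact: leq_addr.
by move/Frow_chain_supp; rewrite ex ey.
Qed.

End Vertical.

Section Horizontal.
Variables (n : nat) (kappa : 'I_n -> F) (rXi rS : nat -> F).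
Hypotheses (hXi : forall i, rXi i != 0) (hS : forall i, rS i != 0).
Hypothesis hsq : forall i j k, (0 < i)%N -> (k <= n)%N ->
  tauS rXi rS k i ^+ 2 * q ^+ j != 1.

Definition tauphi k (la : intpart) : F :=
  powS (tauS rXi rS k) la * cfun q (tauS rXi rS k) la.

Lemma tauS_neq0 k i : tauS rXi rS k i != 0.
Proof. by rewrite /tauS !mulf_neq0 ?invr_eq0. Qed.

Lemma tauXi_neq0 k i : tauXi rXi rS k i != 0.
Proof. by rewrite /tauXi !mulf_neq0 ?invr_eq0. Qed.

Lemma tauS0 : tauS rXi rS 0 = sqseq rS.
Proof. by apply/funext => i; rewrite /tauS /sqseq addn0; field. Qed.

Lemma tauXi0 : tauXi rXi rS 0 = sqseq rXi.
Proof. by apply/funext => i; rewrite /tauXi /sqseq addn0; field. Qed.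

(** With [tau_ratio], this yields the hypotheses [shift] and [ratio] of the row exchange between
    consecutive levels. *)
Lemma tau_prod k i :
  tauXi rXi rS k i * tauS rXi rS k i = sqseq rXi (i + k)%N * sqseq rS (i + k)%N.
Proof. by rewrite /tauXi /tauS /sqseq; field; rewrite hXi hS. Qed.

Lemma tau_ratio k i :
  tauS rXi rS k i / tauXi rXi rS k i = sqseq rS i / sqseq rXi i.
Proof. by rewrite /tauXi /tauS /sqseq; field; rewrite !hXi !hS. Qed.

Lemma tauphi_neq0 k la : (k <= n)%N -> tauphi k la != 0.
Proof.
move=> hk; apply: mulf_neq0.
  by apply: powS_neq0 => i; apply: tauS_neq0.
by apply: cfun_neq0 => // i j hi; apply: hsq.
Qed.

Definition row_t2 (r : 'I_n) (c : nat) : F :=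
  sqseq rXi (r.+1 + c)%N * sqseq rS (r.+1 + c)%N / kappa r.

Definition Grow L N (r : 'I_n) (x y : {ffun 'I_L -> 'I_N.+1}) : F :=
  tauphi r.+1 (boxpart y) / tauphi r (boxpart x)
  * Gkernel q (kappa r) (sqseq rS 0 / sqseq rXi 0) (row_t2 r)
      (tauS rXi rS r.+1) L (boxpart x) (boxpart y).

Lemma Grow_supp L N r (x y : {ffun 'I_L -> 'I_N.+1}) : Grow r x y != 0 ->
  subpart (boxpart y) (boxpart x)
  /\ (size (boxpart x) <= (size (boxpart y)).+1)%N.
Proof.
rewrite mulf_eq0 negb_or => /andP[_ /Gkernel_supp].
by rewrite !size_boxpart => /(_ isT isT).
Qed.

Lemma FF_chain L N (x y : {ffun 'I_L -> 'I_N.+1}) :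
  (ncols (boxpart x) (boxpart y) <= L)%N -> (part (boxpart x) 1 <= N)%N ->
  FF q kappa rXi rS (boxpart x) (boxpart y) = chain_sum (@Grow L N) x y.
Proof.
move=> hL hN; rewrite /FF -tauS0.
rewrite (@chain_sum_gauge F _ n (fun r z => tauphi r (boxpart z))); last first.
  by move=> r z hr; apply: tauphi_neq0.
rewrite -big_chain mulf_div; congr (_ * _).
have hx : (size (boxpart x) <= ncols (boxpart x) (boxpart y))%N.
  by rewrite /ncols ltnW // ltnS leq_maxl.
have hy : (size (boxpart y) <= ncols (boxpart x) (boxpart y))%N.
  by rewrite /ncols ltnW // ltnS leq_maxr.
have hc (r : 'I_n) c i j k l : Wwt q (sqseq rXi (r.+1 + c)%N * sqseq rS (r.+1 + c)%N / kappa r)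
    (tauS rXi rS r.+1 c) i j k l != 0 -> (i + j = k + l)%N.
  by case/Wwt_conserve.
have h0 (r : 'I_n) c : (0 < c)%N ->
    Wwt q (sqseq rXi (r.+1 + c)%N * sqseq rS (r.+1 + c)%N / kappa r)
    (tauS rXi rS r.+1 c) 0 0 0 0 = 1.
  by move=> _; apply: Wwt0.
pose X := {ffun 'I_L -> 'I_N.+1}.
pose ends (k : {ffun 'I_n.+1 -> X}) := (k ord0 == x) && (k ord_max == y).
pose W (k : {ffun 'I_n.+1 -> X}) := \prod_(r < n) row_weight id
  (fun c => Wwt q (row_t2 r c) (tauS rXi rS r.+1 c)) L
  (boxpart (k (widen_ord (leqnSn n) r))) (boxpart (k (lift ord0 r))).
pose A (k : {ffun 'I_n.+1 -> X}) : {ffun 'I_n -> nat} := [ffun r => chain_diff k r].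
set T := (X in \sum_(a \in X) _).
pose pre (a : {ffun 'I_n -> nat}) := \prod_(i < n)
   ((kappa i * tauS rXi rS 0 0 / sqseq rXi 0) ^+ a i
     * (qpoch q ((kappa i)^-1 * tauS rXi rS 0 i.+1 * sqseq rXi i.+1) (a i)
        / qpoch q q (a i))).
have eZ (a : {ffun 'I_n -> nat}) : ZW q kappa rXi rS (boxpart x) (boxpart y) a
    = \sum_(k | ends k && (A k == a)) W k.
  have e := @latticeZ_chain F nat 0%N id id (fun _ => erefl) erefl n _ L N _
    hc h0 a x y hL hN hx hy.
  apply: etrans e _; apply: eq_bigl => k; congr (_ && _).
  apply/forallP/eqP => [h|<- r]; last by rewrite ffunE.
  by apply/ffunP => r; rewrite ffunE (eqP (h r)).
(* The condition on the sum of the left labels is automatic for chains of nonzero weight: the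
   differences of first parts telescope. *)
have hT k : ends k -> W k != 0 -> T (A k).
  move=> /andP[/eqP k0 /eqP k1]; rewrite prodf_seq_neq0 => /allP hW.
  have hsub (r : 'I_n) : (part (boxpart (k (lift ord0 r))) 1
      <= part (boxpart (k (widen_ord (leqnSn n) r))) 1)%N.
    have /row_weight_supp := hW r (mem_index_enum _).
    move=> /(_ id erefl); rewrite !size_boxpart => /(_ _ isT isT) [|h _]; last exact: h.
    by move=> c i j k' l /hc.
  rewrite /T /= -k0 -k1.
  pose g i := part (boxpart (k (inord i))) 1.
  have ge (r : 'I_n.+1) : part (boxpart (k r)) 1 = g r by rewrite /g inord_val.
  have gS (r : 'I_n) : (g r.+1 <= g r)%N.
    have := hsub r; rewrite !ge /=; by rewrite /bump leq0n add1n.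
  rewrite (eq_bigr (fun r : 'I_n => g r - g r.+1)%N); last first.
    by move=> r _; rewrite ffunE /chain_diff !ge /= /bump leq0n add1n.
  rewrite !ge /=; elim: (n) gS => [|n' IH] gS; first by rewrite big_ord0.
  rewrite big_ord_recr /= -IH; last by move=> r; have := gS (widen_ord (leqnSn _) r).
  have := gS ord_max; rewrite /=; lia.
transitivity (\sum_(a \in T) pre a * \sum_(k | ends k && (A k == a)) W k).
  by apply: eq_fsbigr => a _; rewrite eZ.
transitivity (\sum_(k | ends k) pre (A k) * W k); last first.
  apply: eq_bigr => k _; rewrite -big_split /=; apply: eq_bigr => r _.
  rewrite /Gkernel /row_t2 ffunE addn0 tauS0 /qratio /chain_diff.
  congr (_ ^+ _ * (qpoch q _ _ / _) * _); first by rewrite mulrA.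
  by ring.
set r0 := undup [seq A k | k <- enum {: {ffun 'I_n.+1 -> X}} & ends k && (W k != 0)].
have r0P k : ends k -> W k != 0 -> A k \in r0.
  by move=> h1 h2; rewrite mem_undup map_f // mem_filter h1 h2 mem_enum.
rewrite (fsbigE r0).
- rewrite -/r0; under eq_bigr => a _ do rewrite mulr_sumr.
  rewrite (exchange_big_dep ends) /=; last by move=> a k _ /andP[].
  apply: eq_bigr => k hk; have [->|hW] := eqVneq (W k) 0.
    by rewrite mulr0 big1 // => a _; rewrite mulr0.
  rewrite big_mkcond (bigD1_seq (A k)) ?r0P ?undup_uniq //= hk eqxx.
  rewrite (mem_set (hT _ hk hW)) /= big1 ?addr0 // => a ha.
  by rewrite [A k == a]eq_sym (negbTE ha) !andbF.
- exact: undup_uniq.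
- move=> a /=; rewrite mem_undup => /mapP [k]; rewrite mem_filter => /andP[/andP[h1 h2] _] ->.
  exact: hT.
- move=> a _ hA; rewrite big1 ?mulr0 // => k /andP[h1 /eqP h2].
  by apply/eqP; apply: contraNT hA; rewrite -h2; apply: r0P.
Qed.
Lemma Grow_chain_supp L N (x y : {ffun 'I_L -> 'I_N.+1}) :
  chain_sum (@Grow L N) x y != 0 -> subpart (boxpart y) (boxpart x)
  /\ (size (boxpart x) <= size (boxpart y) + n)%N.
Proof.
move=> h; split.
  by apply: chain_sum_subpart h => r x0 y0 /Grow_supp [].
apply: (@chain_sum_rel _ _ n _
  (fun i x y => (size (boxpart x) <= size (boxpart y) + i)%N)) h.
  by move=> x0; rewrite addn0.
by move=> r x0 z y0 k /Grow_supp [_ h1] h2; rewrite addnS (leq_trans h1).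
Qed.

Lemma FF_supp (la mu : intpart) : FF q kappa rXi rS la mu != 0 ->
  subpart mu la /\ (size la <= size mu + n)%N.
Proof.
have hla : (size la <= ncols la mu)%N by rewrite /ncols ltnW // ltnS leq_maxl.
have hmu : (size mu <= ncols la mu)%N by rewrite /ncols ltnW // ltnS leq_maxr.
have [x ex] := boxpart_onto hla (leq_addr (part mu 1) (part la 1)).
have [y ey] := boxpart_onto hmu (leq_addl (part la 1) (part mu 1)).
have := @FF_chain _ _ x y; rewrite ex ey => -> //; last exact: leq_addr.
by move/Grow_chain_supp; rewrite ex ey.
Qed.

End Horizontal.
End Representation.

(** * Assembly in a common box *)

Theorem theorem5p10 (F : fieldType) (q : F) (rXi rS : nat -> F) (n m : nat)
    (kappa : 'I_n -> F) (u : 'I_m -> F)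
    (hn : (0 < n)%N) (hm : (0 < m)%N)
    (hq0 : q != 0)
    (hq : forall k : nat, (0 < k)%N -> q ^+ k != 1)
    (hXi : forall i : nat, rXi i != 0)
    (hS : forall i : nat, rS i != 0)
    (hkappa : forall r : 'I_n, kappa r != 0)
    (hsq : forall i j k : nat, (0 < i)%N -> (k <= n)%N ->
       tauS rXi rS k i ^+ 2 * q ^+ j != 1)
    (hu : forall (r : 'I_m) (i : nat), (0 < i)%N ->
       u r * sqseq rXi i * sqseq rS i != 1)
    (mu nu : intpart) :
  let Xi := sqseq rXi in
  let S := sqseq rS in
  let lhs (la : intpart) := Ftstar q u Xi S la nu * FF q kappa rXi rS la mu in
  let rhs (la : intpart) :=
    FF q kappa rXi rS nu la * Ftstar q u (tauXi rXi rS n) (tauS rXi rS n) mu la in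
  [/\ finite_set [set la : intpart | lhs la != 0],
      finite_set [set la : intpart | rhs la != 0] &
      \sum_(la \in [set: intpart]) lhs la =
      (\prod_(i < n) \prod_(j < m)
         ((1 - u j * kappa i) / (1 - u j * Xi i.+1 * S i.+1)))
      * \sum_(la \in [set: intpart]) rhs la].
Proof.
move=> Xi S lhs rhs.
(* Each row of [FF] adds at most one part and each row of [Ftstar] at most one to the first part, so
   this box holds all nonzero terms and leaves the margins needed for the exchanges. *)
have [L LE] : exists L, L = (size mu + n + size nu).+2 by eexists.
have [N NE] : exists N, N = (part nu 1 + m + part mu 1)%N by eexists.
pose X := {ffun 'I_L -> 'I_N.+1}.
pose f r := @Frow F q m u (tauXi rXi rS r) (tauS rXi rS r) L N.
pose g := @Grow F q n kappa rXi rS L N.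
have hS' k i := tauS_neq0 hXi hS k i.
have hXi' k i := tauXi_neq0 hXi hS k i.
have gS k : (k <= n)%N -> forall i j, (0 < i)%N -> tauS rXi rS k i ^+ 2 * q ^+ j != 1.
  by move=> hk i j hi; apply: hsq.
have hu' k (r : 'I_m) i : (0 < i)%N -> u r * tauXi rXi rS k i * tauS rXi rS k i != 1.
  by move=> hi; rewrite -mulrA (tau_prod hXi hS) mulrA hu // addn_gt0 hi.
have [y ey] : exists y : X, boxpart y = nu by apply: boxpart_onto; lia.
have [z ez] : exists z : X, boxpart z = mu by apply: boxpart_onto; lia.
have lhs_supp la : lhs la != 0 ->
    (part la 1 <= part nu 1 + m)%N /\ (size la <= size mu + n)%N.
  rewrite mulf_eq0 negb_or => /andP[h1 h2]; split.
    move: h1; rewrite /Xi /S -(tauXi0 rXi hS) -(tauS0 rS hXi).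
    by case/(Ftstar_supp hq (hS' 0%N) (gS 0%N isT) (hu' 0%N)).
  by case/(FF_supp hq hXi hS hsq): h2.
have rhs_supp la : rhs la != 0 -> subpart la nu.
  by rewrite mulf_eq0 negb_or => /andP[/(FF_supp hq hXi hS hsq) []].
have lhsE (x : X) : lhs (boxpart x) = chain_sum (f 0%N) x y * chain_sum g x z.
  (* The chain formulas need room in the box, which some [boxpart x] lack; those lie outside the
     support, where both sides vanish. *)
  have [/andP[h1 h2]|h] := boolP ((part (boxpart x) 1 <= part nu 1 + m)%N &&
      (size (boxpart x) <= size mu + n)%N).
    rewrite /lhs /Xi /S -(tauXi0 rXi hS) -(tauS0 rS hXi) -ey -ez.
    rewrite (Ftstar_chain hq (hS' 0%N) (gS 0%N isT) (hu' 0%N)).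
    - rewrite (FF_chain hq kappa hXi hS hsq) //.
        by rewrite ez /ncols; lia.
      by lia.
    - by rewrite ey /ncols; lia.
    - by lia.
  have [->|hl] := eqVneq (lhs (boxpart x)) 0.
    apply/esym/eqP; apply: contraNT h; rewrite mulf_eq0 negb_or => /andP[].
    case/Frow_chain_supp; rewrite ey => _ -> /Grow_chain_supp [_].
    by rewrite ez.
  by case: (lhs_supp _ hl) h => -> ->.
have rhsE (x : X) : rhs (boxpart x) = chain_sum g y x * chain_sum (f n) z x.
  have [h|h] := leqP (size (boxpart x)) (size nu).
    rewrite /rhs -ey -ez (FF_chain hq kappa hXi hS hsq); last 2 first.
    - by rewrite ey /ncols; lia.
    - by rewrite ey; lia.
    rewrite (Ftstar_chain hq (hS' n) (gS n (leqnn n)) (hu' n)) //.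
    - by rewrite ez /ncols; lia.
    - by rewrite ez; lia.
  have -> : chain_sum g y x = 0.
    apply/eqP; apply: contraTT h => /Grow_chain_supp [/subpart_size].
    by rewrite ey -leqNgt.
  rewrite mul0r; apply/eqP; apply: contraTT h => /rhs_supp /subpart_size.
  by rewrite -leqNgt.
have cover_lhs la : lhs la != 0 -> exists x : X, boxpart x = la.
  by case/lhs_supp => h1 h2; apply: boxpart_onto; lia.
have cover_rhs la : rhs la != 0 -> exists x : X, boxpart x = la.
  move=> /rhs_supp h; apply: boxpart_onto.
    by have := subpart_size h; lia.
  by have := h 1%N isT; lia.
have fin (h : intpart -> F) : (forall la, h la != 0 -> exists x : X, boxpart x = la) ->
    finite_set [set la | h la != 0].
  move=> hc; have hX : finite_set (range (@boxpart L N)).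
    by apply: finite_image; apply: finite_finset.
  apply: sub_finite_set hX => la /= /hc [x <-]; exact: imageT.
have sumE (h : intpart -> F) : (forall la, h la != 0 -> exists x : X, boxpart x = la) ->
    \sum_(la \in [set: intpart]) h la = \sum_(x : X) h (boxpart x).
  move=> hc; apply: fsum_finType => //.
  - by move=> x1 x2 _ _; apply: boxpart_inj.
  - by move=> la _ /hc [x <-]; exists x.
split; [exact: fin|exact: fin|].
rewrite !sumE // (eq_bigr _ (fun x _ => lhsE x)) (eq_bigr _ (fun x _ => rhsE x)).
apply: (@chain_exchange F X (fun x : X => part (boxpart x) 1)
  (fun x : X => size (boxpart x)) L n (fun r => chain_sum (f r)) g _ (N - m)).
- move=> i y0 z0 hy0 hz0.
  apply: (@chain_exchange_right F X (fun x : X => part (boxpart x) 1)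
    (fun x : X => size (boxpart x)) N L m (f i) (f i.+1) (g i)) => //.
  + move=> j y1 z1 hy1 hz1.
    have hi : (i < n)%N := ltn_ord i.
    have hin := ltnW hi.
    have shift c : tauXi rXi rS i.+1 c * tauS rXi rS i.+1 c
        = tauXi rXi rS i c.+1 * tauS rXi rS i c.+1.
      by rewrite !(tau_prod hXi hS) addnS addSn.
    have ratio c : tauS rXi rS i.+1 c / tauXi rXi rS i.+1 c
        = tauS rXi rS i c / tauXi rXi rS i c.
      by rewrite !(tau_ratio hXi hS).
    have := row_exchange hq0 hq (hXi' i) (hS' i) (hXi' i.+1) (hS' i.+1) (hkappa i)
      shift ratio (gS i hin) (gS i.+1 hi) (hu' i j) hy1 (size_boxpart y1) hz1.
    (* In the original parameters the product in column [c.+1] at level [i] has index [i + c + 1];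
       for [c = 0] this gives the denominator of the theorem. *)
    have -> : (fun c => tauXi rXi rS i c.+1 * tauS rXi rS i c.+1 / kappa i)
        = row_t2 kappa rXi rS i.
      apply/funext => c; rewrite (tau_prod hXi hS) /row_t2.
      by rewrite !addSn [(c + _)%N]addnC.
    by rewrite (tau_ratio hXi hS) (tau_prod hXi hS) mulrA add1n.
  + by move=> j x0 y1 /Frow_supp [].
  + by move=> j x0 y1 /Frow_supp [/subpart_size].
  + by move: hy0; lia.
- by move=> i x0 z0 /Grow_supp [].
- by move=> i x0 z0 /Grow_supp [h _]; apply: h.
- by rewrite ey; lia.
- by rewrite ez; lia.
Qed.
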